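(* Let $I\subset\mathbb{Z}^d$ be a frequency set with $2\le|I|=T<\infty$ and expansion $N_I$. Fix $0<\delta<1$ and $c\in\mathbb{R}$, $c>1$, and set $$s=\left\lceil\left(\frac{c}{c-1}\right)^2\frac{\ln T-\ln\delta}{2}\right\rceil,\qquad \lambda=\max\{c(T-1),\,N_I,\,4s\ln s\}.$$ Then, with probability at least $1-\delta$, the random construction (D) described in the context, run with this $s$ and $\lambda$, produces a reconstructing multiple rank-1 lattice $\bigcup_{\ell=1}^{\tilde s}\Lambda(\boldsymbol z_\ell,M_\ell)$ for $I$ with pairwise distinct lattice sizes $M_1,\dots,M_{\tilde s}$ that consists of a number $M$ of sampling nodes with $$M\le 2\left\lceil\left(\frac{c}{c-1}\right)^2\frac{\ln T-\ln\delta}{2}\right\rceil\max\{c(T-1),\,N_I,\,4s\ln s\}.$$ If moreover $c(T-1)$ is the largest of the three terms in the maximum, then $$M\le\left\lceil\left(\frac{c}{c-1}\right)^2\frac{\ln T-\ln\delta}{2}\right\rceil 2c(T-1)<C_{c,\delta}\,T\ln T$$ with a constant $C_{c,\delta}$ depending only on $c$ and $\delta$.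
   Context: The expansion of a finite nonempty set $I\subset\mathbb{Z}^d$ is $N_I:=\max_{j=1,\dots,d}\{\max_{\boldsymbol k\in I}k_j-\min_{\boldsymbol l\in I}l_j\}$. For $\boldsymbol z\in\mathbb{Z}^d$, $M\in\mathbb{N}$, the rank-1 lattice is $\Lambda(\boldsymbol z,M)=\{\frac{j}{M}\boldsymbol z\bmod\boldsymbol 1: j=0,\dots,M-1\}\subset[0,1)^d$. A multiple rank-1 lattice is a union $\bigcup_{\ell=1}^{s}\Lambda(\boldsymbol z_\ell,M_\ell)$; it is called reconstructing for $I$ if the matrix $(e^{2\pi i\boldsymbol k\cdot\boldsymbol x})$ with rows indexed by its nodes $\boldsymbol x$ and columns indexed by $\boldsymbol k\in I$ has full column rank. $I_{\bmod M}:=\{\boldsymbol k\bmod M:\boldsymbol k\in I\}$ (componentwise residues in $\{0,\dots,M-1\}$), $P^I:=\{M\in\mathbb{N}: M\text{ prime},\ |I_{\bmod M}|=|I|\}$, and $P^I_{\lambda,s}$ is the set of the $s$ smallest elements of $P^I$ larger than $\lambda$, written $p_1<\dots<p_s$. Construction (D) (given $I$, $s$, $\lambda$): put $\tilde I=\emptyset$, $\tilde s=0$. While $\tilde I\ne I$ and $\tilde s<s$: let $M'=p_{\tilde s+1}$ and draw $\boldsymbol z'\in[0,M'-1]^d\cap\mathbb{Z}^d$ uniformly at random, independently of all previous draws; let $J=\{\boldsymbol k\in I:\ \boldsymbol k\cdot\boldsymbol z'\not\equiv\boldsymbol h\cdot\boldsymbol z'\ (\mathrm{mod}\ M')\text{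 for all }\boldsymbol h\in I\setminus\{\boldsymbol k\}\}$; if $J\not\subset\tilde I$, then increase $\tilde s$ by one, set $M_{\tilde s}=M'$, $\boldsymbol z_{\tilde s}=\boldsymbol z'$ and replace $\tilde I$ by $\tilde I\cup J$; otherwise discard $\boldsymbol z'$. The output is $\bigcup_{\ell=1}^{\tilde s}\Lambda(\boldsymbol z_\ell,M_\ell)$. *)

(* Defs.v *)
From HB Require Import structures.
From mathcomp Require Import all_boot all_order all_algebra finmap.
From mathcomp Require Import complex.
From mathcomp Require Import all_classical all_reals all_analysis.

Set Implicit Arguments.
Unset Strict Implicit.
Unset Printing Implicit Defensive.

Import Order.TTheory GRing.Theory Num.Theory.

Local Open Scope fset_scope.
Local Open Scope ring_scope.

(* The inner maximum and minimum are seeded with an element of I; the seed 0 of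
   the outer maximum is harmless because every spread is nonnegative. *)
Definition expansion (d : nat) (I : {fset 'rV[int]_d}) : int :=
  let k0 := head 0 (enum_fset I) in
  \big[Order.max/0]_(j < d)
    (\big[Order.max/k0 ord0 j]_(k <- enum_fset I) k ord0 j
     - \big[Order.min/k0 ord0 j]_(l <- enum_fset I) l ord0 j).

Definition dotz (d : nat) (k z : 'rV[int]_d) : int :=
  \sum_(j < d) k ord0 j * z ord0 j.

Definition modv (d : nat) (M : nat) (k : 'rV[int]_d) : 'rV[int]_d :=
  map_mx (fun a : int => (a %% M%:Z)%Z) k.

Definition inPI (d : nat) (I : {fset 'rV[int]_d}) : pred nat :=
  fun M => prime M && (#|` [fset modv M k | k in I]| == #|` I|).

Lemma coord_le_expansion (d : nat) (I : {fset 'rV[int]_d}) (k h : 'rV[int]_d)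
    (j : 'I_d) :
  k \in I -> h \in I -> k ord0 j - h ord0 j <= expansion I.
Proof.
move=> kI hI; rewrite /expansion; set k0 := head _ _.
apply: le_trans (le_bigmax _ _ j).
apply: lerB.
  by apply: (@bigmax_sup_seq _ _ _ _ _ k).
by apply: (@bigmin_inf_seq _ _ _ _ _ h).
Qed.

Lemma exists_inPI (R : realType) (d : nat) (I : {fset 'rV[int]_d}) (x : R) :
  exists M : nat, inPI I M && (x < M%:R).
Proof.
have [M ltM prM] := prime_above (maxn `|expansion I| `|Num.ceil x|).
move: ltM; rewrite gtn_max => /andP[ltI ltx].
exists M; rewrite /inPI prM /=; apply/andP; split; last first.
  apply: le_lt_trans (Num.Theory.ceil_ge x) _.
  rewrite -[M%:R]/((M%:Z)%:~R) ltr_int.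
  by apply: le_lt_trans (ler_norm _) _; rewrite -abszE ltz_nat.
apply/eqP/card_in_imfset => k h kI hI /matrixP E.
apply/matrixP => i j; rewrite (ord1 i).
move: (E ord0 j); rewrite !mxE => /eqP.
rewrite eqz_mod_dvd => dv; apply/eqP; rewrite -subr_eq0 -absz_eq0.
move: dv; rewrite -[(_ %| _)%Z]/(_ %| _)%N /=.
case: (posnP `|k ord0 j - h ord0 j|%N) => [->//|gt0] /(dvdn_leq gt0).
rewrite leqNgt => /negP[]; apply: leq_ltn_trans ltI.
rewrite -lez_nat !abszE ler_norml.
have le2 := le_trans (coord_le_expansion j _ _) (ler_norm (expansion I)).
by rewrite lerNl opprB !le2.
Qed.

Definition nextPI (R : realType) (d : nat) (I : {fset 'rV[int]_d}) (x : R) : nat :=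
  ex_minn (exists_inPI I x).

(* Zero-based: enumPI I lam l is the prime p_(l+1) of P^I_(lam,s). *)
Fixpoint enumPI (R : realType) (d : nat) (I : {fset 'rV[int]_d}) (lam : R)
    (l : nat) : nat :=
  if l is l'.+1 then nextPI I ((enumPI I lam l')%:R : R) else nextPI I lam.

Definition rank1_lattice (R : realType) (d : nat) (z : 'rV[int]_d) (M : nat) :
    {fset 'rV[R]_d} :=
  [fset (\row_i (let y := (j%:R / M%:R) * (z ord0 i)%:~R in
                 y - (Num.floor y)%:~R)) | j in iota 0 M].

Definition multiple_lattice (R : realType) (d : nat)
    (L : seq (nat * 'rV[int]_d)) : {fset 'rV[R]_d} :=
  \bigcup_(l <- L) rank1_lattice R l.2 l.1.

Definition expi2pi (R : realType) (t : R) : R[i] :=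
  (cos (2 * pi * t) +i* sin (2 * pi * t))%C.

Definition fourier_matrix (R : realType) (d : nat) (X : {fset 'rV[R]_d})
    (I : {fset 'rV[int]_d}) : 'M[R[i]]_(#|` X|, #|` I|) :=
  \matrix_(a, b)
    let x := nth 0 (enum_fset X) a in
    let k := nth 0 (enum_fset I) b in
    expi2pi (\sum_(j < d) (k ord0 j)%:~R * x ord0 j).

Definition reconstructing (R : realType) (d : nat) (X : {fset 'rV[R]_d})
    (I : {fset 'rV[int]_d}) : Prop :=
  \rank (fourier_matrix X I) = #|` I|.

Definition alias_free (d : nat) (I : {fset 'rV[int]_d}) (M : nat)
    (z : 'rV[int]_d) : {fset 'rV[int]_d} :=
  [fset k in I | all (fun h => (dotz k z != dotz h z %[mod M%:Z])%Z)
                     (enum_fset (I `\ k))].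

(* lattices lists the accepted pairs (M_l, z_l), l = 1, 2, ..., so that s~ is
   its size. *)
Record stateD (d : nat) := StateD {
  covered : {fset 'rV[int]_d};
  lattices : seq (nat * 'rV[int]_d) }.

Section ConstructionD.
Variables (R : realType) (d : nat) (I : {fset 'rV[int]_d}) (s : nat) (lam : R).

Definition runningD (st : stateD d) : bool :=
  (covered st != I) && (size (lattices st) < s)%N.

Definition modulusD (st : stateD d) : nat := enumPI I lam (size (lattices st)).

Definition stepD (st : stateD d) (z : 'rV[int]_d) : stateD d :=
  if runningD st then
    let J := alias_free I (modulusD st) z in
    if ~~ (J `<=` covered st) then
      StateD (covered st `|` J) (rcons (lattices st) (modulusD st, z))
    else st
  else st.

Definition runD (zs : seq 'rV[int]_d) : stateD d :=
  foldl stepD (StateD fset0 [::]) zs.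

(* z n is the n-th draw (from 0).  The box from which it is drawn depends on the
   earlier draws, so "uniform and independent of all previous draws" means that,
   given any history after which the loop is still running, z n is uniform on
   that box.  Nothing is assumed about z n once the loop has stopped. *)
Definition drawsD (disp : measure_display) (Omega : measurableType disp)
    (P : probability Omega R) (z : nat -> Omega -> 'rV[int]_d) : Prop :=
  (forall n v, measurable [set w | z n w = v]%classic) /\
  (forall n (hist : seq 'rV[int]_d) (v : 'rV[int]_d),
    let M' := modulusD (runD hist) in
    let past := [set w | mkseq (z ^~ w) n = hist]%classic in
    runningD (runD hist) ->
    (forall j : 'I_d, 0 <= v ord0 j < M'%:Z) ->
    P (past `&` [set w | z n w = v])%classic
      = (P past * ((M' ^ d)%N%:R^-1)%:E)%E).

End ConstructionD.

Definition numlat (R : realType) (c delta : R) (T : nat) : nat :=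
  `|Num.ceil ((c / (c - 1)) ^+ 2 * ((ln T%:R - ln delta) / 2))|%N.

(* Main.v *)
(* In each draw a frequency k of I is aliased with probability at most
   (T - 1)/M' <= 1/c, since k.z = h.z (mod M') is a nontrivial linear equation
   over the field with M' elements for every h <> k.  Hence, as long as the loop
   runs, the sum of c^(s~ - s) over the uncovered k plus a multiple of
   2^(-s~) r^n, with r = (1 + 1/c)/2 and n the number of draws still to come, is
   a supermartingale; it is at least 1 if I is not covered in the end.  This
   bounds the probability of failure by T c^(-s) + 2^s r^n, whose first term is
   at most delta because ln c >= 2 (1 - 1/c)^2.  Once every k is alias free in
   some lattice, the discrete orthogonality of characters puts each unit vector
   into the row space of the Fourier matrix.  The bound on the number of nodes
   needs s primes in (lambda, 2 lambda] for lambda >= 4 s ln s: Erdos' analysis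
   of the central binomial coefficient provides them for lambda >= 20000, a
   sieve below that. *)
Require Import Defs.
From HB Require Import structures.
From mathcomp Require Import all_boot all_order all_algebra finmap.
From mathcomp Require Import complex.
From mathcomp Require Import all_classical all_reals all_analysis.
From mathcomp Require Import ring lra zify.

Set Implicit Arguments.
Unset Strict Implicit.
Unset Printing Implicit Defensive.

Import Order.TTheory GRing.Theory Num.Theory.
Import numFieldNormedType.Exports.

(** * Primes between n and 2n *)

Lemma prod_nat_leq_expn (I : Type) (r : seq I) (P : pred I) (F : I -> nat) x :
  (forall i, P i -> F i <= x) -> \prod_(i <- r | P i) F i <= x ^ count P r.
Proof.
move=> Fx; elim: r => [|i r IH]; first by rewrite big_nil.
rewrite big_cons /=; case: ifP => [/Fx Fi|_] //.
by rewrite add1n expnS leq_mul.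
Qed.

Lemma prod_primes_dvd (r : seq nat) (P : pred nat) N :
    uniq r -> (forall p, p \in r -> P p -> prime p && (p %| N)) ->
  \prod_(p <- r | P p) p %| N.
Proof.
elim: r => [|q r IH] /=; first by rewrite big_nil dvd1n.
case/andP=> qr ur rN; rewrite big_cons.
have IHr : \prod_(p <- r | P p) p %| N.
  by apply: IH => // p pr; apply: rN; rewrite inE pr orbT.
case: ifP => // Pq.
have /andP[prq qN] := rN q (mem_head _ _) Pq.
rewrite Gauss_dvd ?qN //= big_seq_cond.
apply: (big_ind (fun m => coprime q m)) => [|a b qa qb|p /andP[pr Pp]].
- exact: coprimen1.
- by rewrite coprimeMr qa.
have /andP[prp _] := rN p (mem_behead (s := q :: r) pr) Pp.
rewrite prime_coprime // dvdn_prime2 //.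
by apply: contraNneq qr => ->.
Qed.

Lemma central_binS n :
  n.+1 * 'C(n.+1.*2, n.+1) = 2 * (n.*2.+1) * 'C(n.*2, n).
Proof.
have e1 := mul_bin_diag n.+1.*2 n; have e2 := mul_bin_down n.*2.+1 n.
rewrite doubleS /= in e1 e2 *.
have e3 : n.*2.+1 - n = n.+1 by lia.
rewrite e3 in e2; nia.
Qed.

(** By [central_binS] the right-hand side grows by the factor 2 (2n + 1) / n >= 4 from n to n +
    1. *)
Lemma expn4_leq_central_bin n : 0 < n -> 4 ^ n <= n.*2 * 'C(n.*2, n).
Proof.
elim: n => // -[_ _|n IH _]; first by [].
have := IH isT; have := central_binS n.+1.
rewrite (expnS 4 n.+1); move: (4 ^ _) 'C(_, _) 'C(_, _) => a b c; nia.
Qed.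

Lemma dvdn_fact_prime p n : prime p -> (p %| n`!) = (p <= n).
Proof.
move=> pp; apply/idP/idP => [|pn]; last by rewrite dvdn_fact // prime_gt0.
elim: n => [|n IH]; first by rewrite fact0 Euclid_dvd1.
rewrite factS Euclid_dvdM // => /orP[/dvdn_leq->//|/IH]; exact: leqW.
Qed.

(** Erdos' induction: an even number above 2 adds no prime, and for 2k + 1 the primes in (k + 1, 2k
    + 1] divide C(2k + 1, k), which is at most 4^k. *)
Lemma primorial_leq n : \prod_(1 <= p < n.+1 | prime p) p <= 4 ^ n.
Proof.
elim/ltn_ind: n => -[|[|n]] IH; first by rewrite big_geq.
  by rewrite big_ltn_cond // big_geq.
case: (boolP (odd n)) => [on|en]; last first.
  case: n en IH => [|n] en IH; first by rewrite 2?big_ltn_cond // big_geq.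
  have np : prime n.+3 = false.
    by apply/negP => /even_prime; rewrite /= negbK; move: en => /=; lia.
  rewrite big_mkcond big_nat_recr //= np muln1 -big_mkcond.
  apply: leq_trans (IH n.+2 _) _ => //; by rewrite leq_exp2l.
have [k kE] : exists k, k = n./2.+1 by exists n./2.+1.
have nE : n.+2 = k.*2.+1 by lia.
rewrite nE (@big_cat_nat _ _ _ k.+2) //; try lia.
have -> : k.*2.+1 = k.+1 + k by lia.
rewrite expnD leq_mul //=; first by apply: IH; lia.
apply: (@leq_trans 'C(k.+1 + k, k)).
  apply: dvdn_leq; first by rewrite bin_gt0; lia.
  apply: prod_primes_dvd => [|p]; first exact: iota_uniq.
  rewrite mem_index_iota => kp pp; rewrite pp /=.
  have le_k : k <= k.+1 + k by lia.
  have : p %| (k.+1 + k)`! by rewrite dvdn_fact_prime //; lia.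
  rewrite -(bin_fact le_k) !Euclid_dvdM // !dvdn_fact_prime //.
  by case: (_ %| _) => //=; lia.
(* The two middle coefficients are equal and both occur in the expansion of (1 + 1)^(2k + 1), so
   each is at most 4^k. *)
have : 'C(k.+1 + k, k) + 'C(k.+1 + k, k.+1) <= 2 ^ (k.+1 + k).
  have := expnDn 1 1 (k.+1 + k).
  rewrite -[2]/(1 + 1) => ->.
  have l1 : k < (k.+1 + k).+1 by lia.
  have l2 : k.+1 < (k.+1 + k).+1 by lia.
  rewrite (bigD1 (Ordinal l1)) //= (bigD1 (Ordinal l2)) /=; last first.
    by rewrite -val_eqE /=; lia.
  by rewrite !exp1n !muln1 addnA leq_addr.
rewrite -[in X in _ + X]bin_sub; last by lia.
have -> : k.+1 + k - k.+1 = k by lia.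
have -> : k.+1 + k = (2 * k).+1 by lia.
by rewrite expnS expnM -[2 ^ 2]/4; lia.
Qed.

(** Legendre's formula for (2n)! = C(2n, n) n!^2, written additively to avoid truncated subtraction;
    the terms of n! with k > n vanish. *)
Lemma logn_central_bin_leq n p :
    0 < n -> prime p ->
  logn p 'C(n.*2, n) + \sum_(1 <= k < n.*2.+1) (n %/ p ^ k).*2
  = \sum_(1 <= k < n.*2.+1) n.*2 %/ p ^ k.
Proof.
move=> n_gt0 pp; rewrite -logn_fact //.
have nn : n <= n.*2 by lia.
rewrite -(bin_fact nn); have -> : n.*2 - n = n by lia.
rewrite !lognM ?muln_gt0 ?fact_gt0 ?bin_gt0 ?nn //; congr (_ + _).
rewrite logn_fact // addnn.
rewrite [X in _ = X.*2](_ : _ = \sum_(1 <= k < n.*2.+1) n %/ p ^ k); last first.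
  rewrite [RHS](@big_cat_nat _ _ _ n.+1) //=; try lia.
  rewrite [X in _ + X]big_nat_cond [X in _ + X]big1 ?addn0 // => k /andP[/andP[nk _] _].
  by rewrite divn_small // (leq_ltn_trans _ (ltn_expl _ (prime_gt1 pp))) //; lia.
rewrite -[RHS]mul2n big_distrr /=; by apply: eq_bigr => k _; rewrite mul2n.
Qed.

(** In Legendre's formula each floor(2n / p^k) - 2 floor(n / p^k) is at most 1, and it is 0 once p^k
    > 2n; so the exponent is at most log_p(2n). *)
Lemma expn_logn_central_bin n p :
  0 < n -> prime p -> p ^ logn p 'C(n.*2, n) <= n.*2.
Proof.
move=> n_gt0 pp; have p_gt1 := prime_gt1 pp.
have n2_gt0 : 0 < n.*2 by lia.
apply: leq_trans (trunc_logP p_gt1 n2_gt0).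
rewrite leq_exp2l // -(leq_add2r (\sum_(1 <= k < n.*2.+1) (n %/ p ^ k).*2)).
rewrite logn_central_bin_leq //.
set t := trunc_log _ _.
have t_le : t <= n.*2.
  apply: leq_trans (trunc_logP p_gt1 n2_gt0); apply: ltnW; exact: ltn_expl.
(* As a sum of indicators, [t] can be compared with Legendre's formula term by term. *)
have -> : t = \sum_(1 <= k < n.*2.+1) (k <= t).
  rewrite (@big_cat_nat _ _ _ t.+1) //=.
  rewrite big_nat (eq_bigr (fun=> 1)) => [|k /andP[_]]; last by rewrite ltnS => ->.
  rewrite -big_nat sum_nat_const_nat muln1 subn1 /=.
  rewrite big_nat big1 ?addn0 // => k /andP[]; by rewrite ltnNge => /negbTE->.
rewrite -big_split /= leq_sum // => k _.
case: (leqP k t) => kt.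
  have := divn_eq n (p ^ k).
  have := ltn_pmod n (leq_ltn_trans (leq0n _) (ltn_expl k p_gt1)).
  move=> lt_r {1}->; rewrite doubleD -muln2 mulnAC muln2.
  rewrite divnMDl; last by rewrite expn_gt0 ltnW.
  rewrite addnC leq_add2r.
  by rewrite -ltnS ltn_divLR ?expn_gt0 ?(ltnW p_gt1)//; lia.
rewrite divn_small //; apply: leq_trans (trunc_log_ltn _ p_gt1) _.
by rewrite leq_exp2l.
Qed.

Lemma logn_central_bin_large n p :
  0 < n -> prime p -> n.*2 < p ^ 2 -> logn p 'C(n.*2, n) <= 1.
Proof.
move=> n_gt0 pp lt; rewrite leqNgt; apply/negP => gt1.
have := leq_trans lt (leq_pexp2l (prime_gt0 pp) gt1).
by rewrite ltnNge expn_logn_central_bin.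
Qed.

(** For 2n/3 < p <= n the prime occurs exactly twice in (2n)! and once in each n!, since p >= 3
    gives p^2 > 2n; the occurrences cancel. *)
Lemma logn_central_bin_mid n p :
    prime p -> 2 < p -> n.*2 < 3 * p -> p <= n ->
  logn p 'C(n.*2, n) = 0.
Proof.
move=> pp p2 n3 pn; have n_gt0 : 0 < n by lia.
apply/eqP; rewrite -(eqn_add2r (\sum_(1 <= k < n.*2.+1) (n %/ p ^ k).*2)).
rewrite logn_central_bin_leq // add0n; apply/eqP; apply: eq_big_nat => -[|[|k]] // _.
  rewrite expn1 (_ : n = 1 * p + (n - p)); last by lia.
  rewrite doubleD -!muln2 mulnAC divnMDl ?divnMDl; [|lia|lia].
  by rewrite !divn_small //; lia.
have lt : n.*2 < p ^ k.+2.
  apply: leq_trans n3 _; rewrite expnSr leq_mul2r; apply/orP; right.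
  by apply: leq_trans p2 _; rewrite expnS leq_pmulr // expn_gt0 prime_gt0.
rewrite !divn_small //; apply: leq_ltn_trans lt; rewrite -addnn; exact: leq_addr.
Qed.

(** Beyond the initial cases, one of any two consecutive numbers is even and hence not prime. *)
Lemma count_prime_iota m : count prime (iota 0 m) <= m./2.
Proof.
elim/ltn_ind: m => -[|[|[|[|[|m]]]]] // IH.
have -> : m.+4.+1 = m.+3 + 2 by lia.
rewrite iotaD count_cat /=.
have := IH m.+3 ltac:(lia).
have h q : 2 < q -> ~~ odd q -> prime q = false.
  by move=> q2 /negbTE oq; apply/negP => /even_prime[|]; [lia|rewrite oq].
by case: (boolP (odd m)) => om; [rewrite (h m.+3) | rewrite (h m.+4)] => /=;
  rewrite ?negbK //; case: prime => /=; lia.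
Qed.

(** Both ends of the range are included. *)
Definition primes_between m n := count prime (index_iota m n.+1).

Lemma count_iota_between (P : pred nat) a b m :
  count (fun p => P p && (a <= p <= b)) (iota 0 m) <= count P (index_iota a b.+1).
Proof.
rewrite -!size_filter; apply: uniq_leq_size; first by rewrite filter_uniq ?iota_uniq.
by move=> p; rewrite !mem_filter mem_index_iota ltnS => /andP[/andP[-> ->]].
Qed.

(** Erdos' splitting of C(2n, n): at most (y + 1)/2 primes up to y contribute at most 2n each,
    larger ones up to 2n/3 divide it at most once and multiply to at most 4^(2n/3), those in (2n/3,
    n] are absent, and those in (n, 2n] contribute at most 2n each. One more factor 2n comes from
    [expn4_leq_central_bin]. *)
Lemma primes_between_lower n y : 0 < n -> n.*2 < y.+1 ^ 2 ->
  4 ^ n <= n.*2 ^ (1 + y.+1./2 + primes_between n.+1 n.*2) * 4 ^ (n.*2 %/ 3).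
Proof.
move=> n_gt0 ny.
apply: leq_trans (expn4_leq_central_bin n_gt0) _.
rewrite -addnA expnD expn1 -mulnA leq_mul2l; apply/orP; right.
have C_gt0 : 0 < 'C(n.*2, n) by rewrite bin_gt0; lia.
rewrite -{1}(partnT C_gt0).
rewrite (widen_partn _ (leq_maxl 'C(n.*2, n) n.*2)).
set m := maxn _ _.
have m_ge : n.*2 <= m by exact: leq_maxr.
have n2_gt0 : 0 < n.*2 by lia.
(* [P1] and [P2] may overlap; this is harmless because all factors of [F] at a prime are at least
   1. *)
pose P1 p := prime p && (0 <= p <= y).
pose P2 p := prime p && (p < (n.*2 %/ 3).+1).
pose P3 p := prime p && (n.+1 <= p <= n.*2).
pose F p := (if P1 p then n.*2 else 1) * (if P2 p then p else 1)
            * (if P3 p then n.*2 else 1).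
apply: (@leq_trans (\prod_(0 <= p < m.+1) F p)).
  rewrite (eq_bigl xpredT) //; apply: leq_prod => p _; rewrite /F.
  have [pp|/negbTE np] := boolP (prime p); last first.
    by rewrite /P1 /P2 /P3 np !mul1n lognE np.
  rewrite /P1 /P2 /P3 pp /=.
  have p_gt1 := prime_gt1 pp.
  have L1 := expn_logn_central_bin n_gt0 pp.
  have F2 : 0 < (if p < (n.*2 %/ 3).+1 then p else 1) by case: ifP; lia.
  have F3 : 0 < (if n < p <= n.*2 then n.*2 else 1) by case: ifP; lia.
  case: (leqP p y) => py.
    by apply: leq_trans L1 _; rewrite -mulnA leq_pmulr // muln_gt0 F2.
  rewrite mul1n.
  have p2 : n.*2 < p ^ 2 by apply: leq_trans ny _; rewrite leq_exp2r.
  have L2 := logn_central_bin_large n_gt0 pp p2.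
  have L3 : p ^ logn p 'C(n.*2, n) <= p.
    by rewrite -[X in _ <= X]expn1 leq_exp2l.
  case: ifP => p3; first by apply: leq_trans L3 _; rewrite leq_pmulr.
  rewrite mul1n; case: ifP => pn; first exact: L1.
  have [pn'|pn'] := leqP p n.
    have p_gt2 : 2 < p by move: p2; rewrite -mulnn; nia.
    by rewrite logn_central_bin_mid //; lia.
  case: (posnP (logn p 'C(n.*2, n))) => [->//|l_gt0].
  suff : p <= n.*2 by lia.
  apply: leq_trans L1; by rewrite -{1}[p]expn1 leq_exp2l.
rewrite !big_split /= -!big_mkcond /= expnD mulnAC leq_mul //.
  apply: leq_mul.
    apply: leq_trans (prod_nat_leq_expn _ (x := n.*2) _) _ => //.
    rewrite leq_pexp2l //.
    apply: leq_trans (count_iota_between _ _ _ _) _.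
    exact: count_prime_iota.
  apply: leq_trans (prod_nat_leq_expn _ (x := n.*2) _) _ => //.
  rewrite leq_pexp2l //.
  exact: count_iota_between.
rewrite -big_nat_widen; last by rewrite ltnS (leq_trans (leq_div _ _)).
by rewrite big_ltn_cond //=; exact: primorial_leq.
Qed.

(** * A sieve *)

(** Sets the entries at j, j + q, j + 2q, ... to false; [j] counts down to the next entry to be
    struck, so no division is computed. *)
Fixpoint strike (q j : nat) (l : seq bool) : seq bool :=
  if l is b :: l' then
    if j is j'.+1 then b :: strike q j' l' else false :: strike q q.-1 l'
  else [::].

Lemma nth_strike q j l i t : 0 < q ->
  nth false (strike q j l) i -> nth false l i && (i != j + t * q).
Proof.
move=> q_gt0; elim: l i j t => [|b l IH] [|i] [|j] t //=; rewrite ?nth_nil //.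
- by move=> ->.
- case: t => [|t]; first by move=> /(IH _ _ 0) /andP[->].
  by move=> /(IH _ _ t) /andP[-> /=]; rewrite mulSn; lia.
- by move=> /(IH _ _ t) /andP[-> /=]; lia.
Qed.

(** Entry i stands for the number i; striking starts at 2q to spare q itself. *)
Definition sieve (qs : seq nat) (n : nat) : seq bool :=
  foldr (fun q => strike q q.*2) (false :: false :: nseq n true) qs.

Lemma nth_sieve qs n i : all (ltn 1) qs -> nth false (sieve qs n) i ->
  (1 < i) && all (fun q => ~~ ((q %| i) && (1 < i %/ q))) qs.
Proof.
elim: qs => [|q qs IH] /=; first by case: i => [|[|i]].
case/andP=> q_gt1 qs_gt1 h; have q_gt0 := ltnW q_gt1.
have /andP[/(IH qs_gt1)/andP[-> ->] _] := nth_strike 0 q_gt0 h.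
rewrite andbT /=; apply/negP => /andP[qi iq].
(* As striking starts at 2q, the multiple i = q (i / q) is struck at count i / q - 2. *)
have /andP[_ /eqP[]] := nth_strike (i %/ q - 2) q_gt0 h.
by rewrite -{1}(divnK qi); nia.
Qed.

(** The least prime factor of a composite number below (B + 1)^2 is at most B, hence one of the
    sieving primes. *)
Lemma sieve_prime B n i :
    i < B.+1 ^ 2 ->
  nth false (sieve [seq q <- iota 2 B.-1 | prime q] n) i -> prime i.
Proof.
move=> iB h; 
have qs_gt1 : all (ltn 1) [seq q <- iota 2 B.-1 | prime q].
  by apply/allP => q; rewrite mem_filter => /andP[/prime_gt1].
have /andP[i_gt1 /allP h'] := nth_sieve qs_gt1 h.
apply: contraT => npi.
have hq := @ltn_pdiv2_prime i (ltnW i_gt1); set q := pdiv i in hq.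
have pq : prime q by exact: pdiv_prime.
have q2 : q ^ 2 <= i by rewrite leqNgt; apply: contra npi => /hq.
have qB : q <= B by rewrite -ltnS -(@ltn_exp2r _ _ 2) // (leq_ltn_trans q2).
have q_gt1 := prime_gt1 pq; have q_gt0 := ltnW q_gt1.
have : q \in [seq q <- iota 2 B.-1 | prime q].
  by rewrite mem_filter pq mem_iota; lia.
move/h'; rewrite pdiv_dvd /= => /negP[].
by apply: leq_trans q_gt1 _; rewrite -/q leq_divRL.
Qed.

Lemma count_take_drop_leq (P : pred nat) l a k :
    (forall i, i < a + k -> nth false l i -> P i) ->
  count id (take k (drop a l)) <= count P (iota a k).
Proof.
elim: k a => [|k IH] a lP; first by rewrite take0.
have [la|la] := ltnP a (size l); last by rewrite drop_oversize.
rewrite (drop_nth false) //= leq_add //.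
  by case E : nth => //=; rewrite lP //; lia.
by apply: IH => i ik; apply: lP; lia.
Qed.

Lemma count_sieve_leq B n a b :
    b < B.+1 ^ 2 ->
  count id (take (b.+1 - a) (drop a (sieve [seq q <- iota 2 B.-1 | prime q] n)))
    <= primes_between a b.
Proof.
move=> bB; rewrite /primes_between /index_iota.
have [ab|ba] := leqP a b; last by (have -> : b.+1 - a = 0 by lia); rewrite take0.
apply: count_take_drop_leq => i ib; apply: sieve_prime.
by apply: leq_ltn_trans bB; lia.
Qed.

(** The windows below ask for primes up to 28700, which is less than 201^2. *)
Definition prime_table := sieve [seq q <- iota 2 200.-1 | prime q] (287 * 100).

Lemma count_prime_table_leq a b : b < 201 ^ 2 ->
  count id (take (b.+1 - a) (drop a prime_table)) <= primes_between a b.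
Proof. exact: count_sieve_leq. Qed.

(* (a, b, g) stands for the windows a <= 2 lambda < b; the primes counted in
   prime_windows_count then lie in (lambda, 2 lambda], and prime_windows_ln shows
   that 4 s ln s <= lambda forces s < g. *)
Definition prime_windows : seq (nat * nat * nat) :=
  [:: (2, 4, 2); (4, 6, 2); (6, 10, 2); (10, 11, 2); (11, 14, 3); (14, 22, 3);
   (22, 26, 3); (26, 34, 4); (34, 44, 4); (44, 62, 5); (62, 85, 6);
   (85, 118, 8); (118, 158, 10); (158, 206, 12); (206, 278, 14); (278, 358, 20);
   (358, 476, 20); (476, 626, 28); (626, 866, 32); (866, 1175, 40);
   (1175, 1594, 56); (1594, 2128, 64); (2128, 2854, 96); (2854, 4006, 112);
   (4006, 54 * 100, 160); (54 * 100, 74 * 100, 192);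
   (74 * 100, 102 * 100, 256); (102 * 100, 146 * 100, 320);
   (146 * 100, 206 * 100, 448); (206 * 100, 287 * 100, 640);
   (287 * 100, 400 * 100, 768)].

(** Checked by computation. Since s < g will be known, g - 1 primes are enough, whence the
    successor. *)
Lemma prime_windows_count :
  all (fun w => w.2 <= (primes_between (uphalf w.1.2) w.1.1).+1) prime_windows.
Proof.
have /allP h1 : all (fun w => w.1.1 < 201 ^ 2) prime_windows.
  by vm_cast_no_check (erefl true).
have /allP h2 : all (fun w => w.2 <= (count id (take (w.1.1.+1 - uphalf w.1.2)
         (drop (uphalf w.1.2) prime_table))).+1) prime_windows.
  by vm_cast_no_check (erefl true).
apply/allP => w ww; apply: leq_trans (h2 w ww) _; rewrite ltnS.
exact: count_prime_table_leq (h1 w ww).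
Qed.

Local Open Scope fset_scope.
Local Open Scope ring_scope.

(** * Bounds on logarithms *)

Section log_bounds.
Variable R : realType.
Implicit Types x c : R.

Lemma is_derive_ge0_ge1 (f df : R -> R) :
    (forall x, 1 <= x -> is_derive x 1 f (df x)) ->
    (forall x, 1 <= x -> 0 <= df x) ->
  forall x, 1 <= x -> f 1 <= f x.
Proof.
move=> fE df_ge0 x x_ge1.
have fd y : y \in `]1, x[ -> is_derive y 1 f (df y).
  by rewrite in_itv /= => /andP[/ltW y_ge1 _]; exact: fE.
apply: (@ger0_derive1_le_cc _ f 1 x) => //; rewrite ?in_itv /= ?lexx ?x_ge1 //.
- by move=> y /fd /@ex_derive.
- move=> y yx; have [_] := fd y yx; rewrite derive1E => ->.
  by apply: df_ge0; move: yx; rewrite in_itv /= => /andP[/ltW].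
- apply: derivable_within_continuous => y; rewrite in_itv /= => /andP[y_ge1 _].
  by have /@ex_derive := fE y y_ge1.
Qed.

Lemma ln_le_subr1 x : 0 < x -> ln x <= x - 1.
Proof.
move=> x_gt0; have := @le_ln1Dx R (x - 1).
by have -> : 1 + (x - 1) = x; [lra|apply; lra].
Qed.

Lemma ln_ge_subr1V x : 0 < x -> 1 - x^-1 <= ln x.
Proof.
move=> x_gt0; have := @ln_le_subr1 x^-1; rewrite invr_gt0 lnV ?posrE// => /(_ x_gt0).
lra.
Qed.

(** The function (y + 1) ln y - 2 (y - 1) vanishes at 1 and has the derivative ln y + 1/y - 1 >=
    0. *)
Lemma ln_ge_pade x : 1 <= x -> 2 * (x - 1) / (x + 1) <= ln x.
Proof.
move=> x_ge1; rewrite ler_pdivrMr; last by lra.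
rewrite -subr_ge0.
pose f : R -> R := (@ln R * (id + cst 1)) - (2 *: (id - cst 1)).
have fE y : f y = ln y * (y + 1) - 2 * (y - 1) by [].
have -> : 0 = f 1 by rewrite fE ln1; lra.
rewrite -fE.
apply: (@is_derive_ge0_ge1 f (fun y => ln y + (y + 1) / y - 2) _ _ x x_ge1).
  move=> y y_ge1; have y_gt0 : 0 < y by lra.
  have D := is_deriveB (is_deriveM (is_derive1_ln y_gt0)
    (is_deriveD (is_derive_id y 1) (is_derive_cst (1 : R) y 1)))
    (is_deriveZ 2 (is_deriveB (is_derive_id y 1) (is_derive_cst (1 : R) y 1))).
  apply: is_derive_eq D _.
  rewrite /GRing.scale /= subr0 addr0 /cst /= !mulr1.
  by congr (_ + _ - _).
move=> y y_ge1; have y_gt0 : 0 < y by lra.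
have := ln_ge_subr1V y_gt0.
have -> : (y + 1) / y = 1 + y^-1 by field; lra.
lra.
Qed.

(** The right-hand side is the trapezoidal rule for the integral of 1/t over [1, x]. The proof
    differentiates y^2 - 1 - 2 y ln y, which gives 2 (y - 1 - ln y) >= 0. *)
Lemma ln_le_trapezoid x : 1 <= x -> ln x <= (x - x^-1) / 2.
Proof.
move=> x_ge1; have x_gt0 : 0 < x by lra.
suff : 0 <= x * x - 1 - 2 * (ln x * x).
  have -> : (x - x^-1) / 2 = (x * x - 1) / (2 * x) by field; lra.
  by rewrite ler_pdivlMr; [lra|lra].
pose f : R -> R := (id * id - cst 1) - (2 *: (@ln R * id)).
have fE y : f y = y * y - 1 - 2 * (ln y * y) by [].
have -> : 0 = f 1 by rewrite fE ln1; lra.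
rewrite -fE.
apply: (@is_derive_ge0_ge1 f (fun y => 2 * (y - 1 - ln y)) _ _ x x_ge1).
  move=> y y_ge1; have y_gt0 : 0 < y by lra.
  have D := is_deriveB (is_deriveB (is_deriveM (is_derive_id y 1) (is_derive_id y 1))
    (is_derive_cst (1 : R) y 1))
    (is_deriveZ 2 (is_deriveM (is_derive1_ln y_gt0) (is_derive_id y 1))).
  apply: is_derive_eq D _.
  rewrite /GRing.scale /= subr0 !mulr1 mulfV; lra.
move=> y y_ge1; have := @ln_le_subr1 y; lra.
Qed.

Lemma ln16_15 : 2 / 31 <= ln (16 / 15 : R) <= 31 / 480.
Proof.
have h : 1 <= 16 / 15 :> R by lra.
have := ln_ge_pade h; have := ln_le_trapezoid h.
have -> : (16 / 15 - (16 / 15)^-1) / 2 = 31 / 480 :> R by field.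
have -> : 2 * (16 / 15 - 1) / (16 / 15 + 1) = 2 / 31 :> R by field.
by move=> -> ->.
Qed.

Lemma ln25_24 : 2 / 49 <= ln (25 / 24 : R) <= 49 / 1200.
Proof.
have h : 1 <= 25 / 24 :> R by lra.
have := ln_ge_pade h; have := ln_le_trapezoid h.
have -> : (25 / 24 - (25 / 24)^-1) / 2 = 49 / 1200 :> R by field.
have -> : 2 * (25 / 24 - 1) / (25 / 24 + 1) = 2 / 49 :> R by field.
by move=> -> ->.
Qed.

Lemma ln81_80 : 2 / 161 <= ln (81 / 80 : R) <= 161 / 12960.
Proof.
have h : 1 <= 81 / 80 :> R by lra.
have := ln_ge_pade h; have := ln_le_trapezoid h.
have -> : (81 / 80 - (81 / 80)^-1) / 2 = 161 / 12960 :> R by field.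
have -> : 2 * (81 / 80 - 1) / (81 / 80 + 1) = 2 / 161 :> R by field.
by move=> -> ->.
Qed.


Lemma lnXM n x y : 0 < x -> 0 < y -> ln (x ^+ n * y) = n%:R * ln x + ln y.
Proof. by move=> x0 y0; rewrite lnM ?posrE ?exprn_gt0 // lnXn // mulr_natl. Qed.

(* 16/15, 25/24 and 81/80 are so close to 1 that the bounds above are sharp. *)
Lemma ln_235 :
  [/\ ln 2 = 7 * ln (16 / 15) + 5 * ln (25 / 24) + 3 * ln (81 / 80) :> R,
      ln 3 = 11 * ln (16 / 15) + 8 * ln (25 / 24) + 5 * ln (81 / 80) :> R &
      ln 5 = 16 * ln (16 / 15) + 12 * ln (25 / 24) + 7 * ln (81 / 80) :> R].
Proof.
have e1 : ln (16 / 15 : R) = 4 * ln 2 - ln 3 - ln 5.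
  rewrite ln_div ?posrE //; have -> : 16 = 2 ^+ 4 * 1 :> R by lra.
  have -> : 15 = 3 ^+ 1 * 5 :> R by lra.
  rewrite !lnXM // ln1; lra.
have e2 : ln (25 / 24 : R) = 2 * ln 5 - 3 * ln 2 - ln 3.
  rewrite ln_div ?posrE //; have -> : 25 = 5 ^+ 2 * 1 :> R by lra.
  have -> : 24 = 2 ^+ 3 * 3 :> R by lra.
  rewrite !lnXM // ln1; lra.
have e3 : ln (81 / 80 : R) = 4 * ln 3 - 4 * ln 2 - ln 5.
  rewrite ln_div ?posrE //; have -> : 81 = 3 ^+ 4 * 1 :> R by lra.
  have -> : 80 = 2 ^+ 4 * 5 :> R by lra.
  rewrite !lnXM // ln1; lra.
by rewrite e1 e2 e3; split; lra.
Qed.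

Lemma ln2_bounds : 4331 / 6250 <= ln (2 : R) <= 867 / 1250.
Proof.
by have [-> _ _] := ln_235; have := ln16_15; have := ln25_24; have := ln81_80; lra.
Qed.

Lemma ln3_ge : 549 / 500 <= ln 3 :> R.
Proof.
by have [_ -> _] := ln_235; have := ln16_15; have := ln25_24; have := ln81_80; lra.
Qed.

Lemma ln5_bounds : 1609 / 1000 <= ln (5 : R) <= 2013 / 1250.
Proof.
by have [_ _ ->] := ln_235; have := ln16_15; have := ln25_24; have := ln81_80; lra.
Qed.

Lemma ln7_ge : 389 / 200 <= ln 7 :> R.
Proof.
(* 2^5 * 3 * 5^2 = 2400 lies just below 7^4 = 2401. *)
have : ln (2 ^+ 5 * (3 ^+ 1 * (5 ^+ 2 * 1))) <= ln (7 ^+ 4 * 1) :> R.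
  by rewrite ler_ln ?posrE; lra.
rewrite !lnXM ?ln1; try lra.
have := ln2_bounds; have := ln3_ge; have := ln5_bounds; lra.
Qed.

End log_bounds.

(** * Primes between lambda and 2 lambda *)

Section enough_primes.
Variable R : realType.
Implicit Types x : R.

(** All numbers g in [prime_windows] are products of powers of 2, 3, 5 and 7, so this bounds their
    logarithms from below. *)
Lemma ln_smooth_ge (a b c d : nat) :
  4331 / 6250 * a%:R + 549 / 500 * b%:R + 1609 / 1000 * c%:R + 389 / 200 * d%:R
    <= ln (2 ^ a * 3 ^ b * 5 ^ c * 7 ^ d)%N%:R :> R.
Proof.
rewrite !natrM !natrX -!mulrA !lnXM ?mulr_gt0 ?exprn_gt0 //.
have /andP[h2 _] := ln2_bounds R; have h3 := ln3_ge R.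
have /andP[h5 _] := ln5_bounds R; have h7 := ln7_ge R.
rewrite lnXn // -[_ *+ d]mulr_natl.
have la := ler_wpM2l (ler0n R a) h2; have lb := ler_wpM2l (ler0n R b) h3.
have lc := ler_wpM2l (ler0n R c) h5; have ld := ler_wpM2l (ler0n R d) h7.
move: la lb lc ld; clear; lra.
Qed.

Lemma prime_windows_ln w : w \in prime_windows ->
  w.1.2%:R <= 8 * w.2%:R * ln w.2%:R :> R.
Proof.
move: w; apply/allP; unfold prime_windows; cbn [all fst snd].
repeat (apply/andP; split); last by [].
- have := ln_smooth_ge 1 0 0 0; rewrite -[(2 ^ _ * _ * _ * _)%N]/2%N; lra.
- have := ln_smooth_ge 1 0 0 0; rewrite -[(2 ^ _ * _ * _ * _)%N]/2%N; lra.
- have := ln_smooth_ge 1 0 0 0; rewrite -[(2 ^ _ * _ * _ * _)%N]/2%N; lra.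
- have := ln_smooth_ge 1 0 0 0; rewrite -[(2 ^ _ * _ * _ * _)%N]/2%N; lra.
- have := ln_smooth_ge 0 1 0 0; rewrite -[(2 ^ _ * _ * _ * _)%N]/3%N; lra.
- have := ln_smooth_ge 0 1 0 0; rewrite -[(2 ^ _ * _ * _ * _)%N]/3%N; lra.
- have := ln_smooth_ge 0 1 0 0; rewrite -[(2 ^ _ * _ * _ * _)%N]/3%N; lra.
- have := ln_smooth_ge 2 0 0 0; rewrite -[(2 ^ _ * _ * _ * _)%N]/4%N; lra.
- have := ln_smooth_ge 2 0 0 0; rewrite -[(2 ^ _ * _ * _ * _)%N]/4%N; lra.
- have := ln_smooth_ge 0 0 1 0; rewrite -[(2 ^ _ * _ * _ * _)%N]/5%N; lra.
- have := ln_smooth_ge 1 1 0 0; rewrite -[(2 ^ _ * _ * _ * _)%N]/6%N; lra.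
- have := ln_smooth_ge 3 0 0 0; rewrite -[(2 ^ _ * _ * _ * _)%N]/8%N; lra.
- have := ln_smooth_ge 1 0 1 0; rewrite -[(2 ^ _ * _ * _ * _)%N]/10%N; lra.
- have := ln_smooth_ge 2 1 0 0; rewrite -[(2 ^ _ * _ * _ * _)%N]/12%N; lra.
- have := ln_smooth_ge 1 0 0 1; rewrite -[(2 ^ _ * _ * _ * _)%N]/14%N; lra.
- have := ln_smooth_ge 2 0 1 0; rewrite -[(2 ^ _ * _ * _ * _)%N]/20%N; lra.
- have := ln_smooth_ge 2 0 1 0; rewrite -[(2 ^ _ * _ * _ * _)%N]/20%N; lra.
- have := ln_smooth_ge 2 0 0 1; rewrite -[(2 ^ _ * _ * _ * _)%N]/28%N; lra.
- have := ln_smooth_ge 5 0 0 0; rewrite -[(2 ^ _ * _ * _ * _)%N]/32%N; lra.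
- have := ln_smooth_ge 3 0 1 0; rewrite -[(2 ^ _ * _ * _ * _)%N]/40%N; lra.
- have := ln_smooth_ge 3 0 0 1; rewrite -[(2 ^ _ * _ * _ * _)%N]/56%N; lra.
- have := ln_smooth_ge 6 0 0 0; rewrite -[(2 ^ _ * _ * _ * _)%N]/64%N; lra.
- have := ln_smooth_ge 5 1 0 0; rewrite -[(2 ^ _ * _ * _ * _)%N]/96%N; lra.
- have := ln_smooth_ge 4 0 0 1; rewrite -[(2 ^ _ * _ * _ * _)%N]/112%N; lra.
- have := ln_smooth_ge 5 0 1 0; rewrite -[(2 ^ _ * _ * _ * _)%N]/160%N; lra.
- have := ln_smooth_ge 6 1 0 0; rewrite -[(2 ^ _ * _ * _ * _)%N]/192%N; lra.
- have := ln_smooth_ge 8 0 0 0; rewrite -[(2 ^ _ * _ * _ * _)%N]/256%N; lra.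
- have := ln_smooth_ge 6 0 1 0; rewrite -[(2 ^ _ * _ * _ * _)%N]/320%N; lra.
- have := ln_smooth_ge 6 0 0 1; rewrite -[(2 ^ _ * _ * _ * _)%N]/448%N; lra.
- have := ln_smooth_ge 7 0 1 0; rewrite -[(2 ^ _ * _ * _ * _)%N]/640%N; lra.
- have := ln_smooth_ge 8 1 0 0; rewrite -[(2 ^ _ * _ * _ * _)%N]/768%N; lra.
Qed.

(** Each window starts where its predecessor ends, so together they leave no gap. *)
Lemma chain_cover (l : seq (nat * nat * nat)) w0 x :
    path (fun u v => u.1.2 == v.1.1) w0 l ->
    w0.1.1%:R <= x -> x < (last w0 l).1.2%:R ->
  exists2 w, w \in w0 :: l & w.1.1%:R <= x < w.1.2%:R.
Proof.
elim: l w0 => [|v l IH] w0 /=.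
  by move=> _ h1 h2; exists w0; rewrite ?mem_head // h1.
case/andP=> /eqP wv vl h1 h2; have [lt|ge] := ltrP x w0.1.2%:R.
  by exists w0; rewrite ?mem_head // h1.
rewrite wv in ge; have [w wl hw] := IH v vl ge h2.
by exists w => //; rewrite inE wl orbT.
Qed.

Lemma mul_ln_le (m n : nat) : (0 < m <= n)%N -> m%:R * ln m%:R <= n%:R * ln n%:R :> R.
Proof.
case/andP=> m0 mn; have n0 : (0 < n)%N by exact: leq_trans mn.
apply: ler_pM => //; first by rewrite ln_ge0 // ler1n.
  by rewrite ler_nat.
by rewrite ler_ln ?posrE ?ltr0n // ler_nat.
Qed.

Lemma enough_primes_small (lam : R) (s : nat) :
    (0 < s)%N -> 1 <= lam -> 2 * lam < (400 * 100)%N%:R -> 4 * s%:R * ln s%:R <= lam ->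
  exists a b : nat, [/\ lam < a%:R, b%:R <= 2 * lam & (s <= primes_between a b)%N].
Proof.
move=> s0 lam1 lamN slam.
have [|||w ww /andP[aw wb]] :=
  @chain_cover (behead prime_windows) (2, 4, 2)%N (2 * lam).
- by vm_compute.
- by rewrite /=; lra.
- exact: lamN.
- exists (uphalf w.1.2), w.1.1; split => //.
    apply: (@lt_le_trans _ _ (w.1.2%:R / 2)); first lra.
    rewrite ler_pdivrMr // -natrM ler_nat; lia.
  have wm : (w.2 <= (primes_between (uphalf w.1.2) w.1.1).+1)%N.
    exact: allP prime_windows_count w ww.
  (* With w = (a, b, g), s >= g would give 2 [lam] >= 8 s ln s >= 8 g ln g >= b, against 2 [lam] <
     b. *)
  suff sw : (s < w.2)%N by rewrite -ltnS (leq_trans sw).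
  have := prime_windows_ln ww.
  apply: contraTT; rewrite -leqNgt -ltNge => gs.
  have w0 : (0 < w.2)%N.
    by have : all (fun w => 0 < w.2)%N prime_windows by []; move/allP/(_ w ww).
  have := @mul_ln_le w.2 s; rewrite w0 gs => /(_ isT); lra.
Qed.

End enough_primes.

Lemma sqrtn_exists m : exists y, (y ^ 2 <= m < y.+1 ^ 2)%N.
Proof.
elim: m => [|m [y /andP[y1 y2]]]; first by exists 0%N.
have [e|ne] := eqVneq m.+1 (y.+1 ^ 2)%N.
  exists y.+1; rewrite -e leqnn /= e ltn_exp2r //.
exists y; rewrite (leqW y1) /= ltn_neqAle ne; exact: y2.
Qed.

(** * Primes between lambda and 2 lambda for large lambda *)

Section enough_primes_large.
Variable R : realType.
Implicit Types x : R.

Lemma ln_le_tangent a x : 0 < a -> 0 < x -> ln x <= x / a + ln a - 1.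
Proof.
move=> a0 x0; have := @ln_le_subr1 R (x / a); rewrite divr_gt0 // => /(_ isT).
by rewrite ln_div ?posrE //; lra.
Qed.

(** The tangent to ln at 200 gives ln z <= 2 ln Y <= Y/100 + 2 (ln 200 - 1), and 2 (ln 200 - 1) <
    0.044 * 200. *)
Lemma ln_sqr_le (Y z : R) : 200 <= Y -> 0 < z -> z <= Y ^+ 2 -> ln z <= 54 / 1000 * Y.
Proof.
move=> Y200 z0 zY; have Y0 : 0 < Y by lra.
have : ln z <= ln (Y ^+ 2 * 1) by rewrite ler_ln ?posrE // ?mulr1 // exprn_gt0.
rewrite lnXM // ln1; have := @ln_le_tangent 200 Y ltac:(lra) Y0.
have -> : 200 = 2 ^+ 3 * (5 ^+ 2 * 1) :> R by lra.
rewrite !lnXM ?ln1 ?mulr_gt0 ?exprn_gt0 //.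
have := ln2_bounds R; have := ln5_bounds R; lra.
Qed.

(* The tangent to ln at 8 S ln S is used, which is close to 2n in the critical
   case 4 S ln S = n. *)
Lemma mul_ln_double_le (S n : R) : 700 <= S -> 0 < n -> 4 * (S * ln S) <= n + 1 ->
  S * ln (2 * n) <= 402 / 1000 * n + 1.
Proof.
move=> S700 n0; set t := ln S => St; have S0 : 0 < S by lra.
(* ln S >= ln 700, and 700 = 2^2 * 5^2 * 7. *)
have t_ge : 6548 / 1000 <= t.
  have : ln (2 ^+ 2 * (5 ^+ 2 * (7 ^+ 1 * 1))) <= t by rewrite ler_ln ?posrE; lra.
  rewrite !lnXM ?ln1 ?mulr_gt0 ?exprn_gt0 //.
  by have := ln2_bounds R; have := ln5_bounds R; have := ln7_ge R; lra.
have t0 : 0 < t by lra.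
(* The tangent to ln at 32/5, close to the least possible value of [t]. *)
have t1 : ln t <= t / (32 / 5) + 859 / 1000.
  have := @ln_le_tangent (32 / 5) t ltac:(lra) t0.
  rewrite ln_div ?posrE //; have -> : 32 = 2 ^+ 5 * 1 :> R by lra.
  by rewrite lnXM // ln1; have := ln2_bounds R; have := ln5_bounds R; lra.
have St0 : 0 < S * t by rewrite mulr_gt0.
have := @ln_le_tangent (2 ^+ 3 * (S * t)) (2 * n) ltac:(lra) ltac:(lra).
rewrite lnXM // [ln (S * t)]lnM ?posrE // -/t => hL.
have h1 : S * (2 * n / (2 ^+ 3 * (S * t))) <= 10 / 261 * n.
  have -> : S * (2 * n / (2 ^+ 3 * (S * t))) = n / (4 * t).
    by field; rewrite !gt_eqF.
  rewrite ler_pdivrMr; last by lra.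
  nra.
have h2 : ln (2 * n) <= 2 * n / (2 ^+ 3 * (S * t)) + (37 / 32 * t + 194 / 100).
  have := ln2_bounds R; lra.
have h3 := ler_wpM2l (ltW S0) h2.
rewrite mulrDr [S * (_ + _)]mulrDr in h3.
have h4 : S * (6548 / 1000) <= S * t by rewrite ler_wpM2l // ltW.
move: St n0 h1 h3 h4; clear; lra.
Qed.

(** With fewer than s primes in (n, 2n], the logarithm of [primes_between_lower] yields (2/3) n ln 2
    <= (s + Y/2) ln(2n), Y being about sqrt(2n). The left side exceeds 0.461 n, while the right side
    is at most 0.402 n + 1 plus 0.027 Y^2 <= 0.0551 n. *)
Lemma enough_primes_large (n s : nat) :
    (200 * 100 <= n)%N -> 4 * (s%:R * ln s%:R) <= n%:R + 1 :> R ->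
  (s <= primes_between n.+1 n.*2)%N.
Proof.
move=> n_ge sn; rewrite leqNgt; apply/negP => lt_s.
have n_geR : (200 * 100)%:R <= n%:R :> R by rewrite ler_nat.
have n0 : (0 < n)%N by exact: leq_trans n_ge.
have n0R : 0 < n%:R :> R by rewrite ltr0n.
have [y /andP[y1 y2]] := sqrtn_exists n.*2.
have e_bound m : (m < s)%N -> (2 * (1 + y.+1./2 + m) <= 2 * s + y.+1)%N.
  by clear; lia.
set Y : R := y.+1%:R.
have y_ge : (199 < y)%N.
  rewrite ltnNge; apply/negP => y_le.
  have : (y.+1 ^ 2 <= 200 ^ 2)%N by rewrite leq_exp2r.
  by move: y2 n_ge; rewrite -mul2n; lia.
have Y2 : Y ^+ 2 <= 102 / 100 * (2 * n%:R).
  have : (y ^ 2)%:R <= (2 * n)%:R :> R by rewrite ler_nat mul2n.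
  have : 199%:R <= y%:R :> R by rewrite ler_nat ltnW.
  rewrite /Y -natr1 natrX natrM; nra.
have Y200 : 200 <= Y by rewrite /Y ler_nat ltnS ltnW.
set L := ln (2 * n%:R : R).
have nY : 2 * n%:R <= Y ^+ 2 by rewrite /Y -natrX -natrM mul2n ler_nat ltnW.
have L_le : L <= 54 / 1000 * Y.
  exact: ln_sqr_le Y200 (mulr_gt0 (ltr0Sn R 1) n0R) nY.
have L0 : 0 <= L by rewrite ln_ge0 //; lra.
have sL : s%:R * L <= 402 / 1000 * n%:R + 1.
  (* For s <= 700 the estimate for 700 is used; it applies because 4 * 700 ln 700 < 20000. *)
  have [s_le|s_ge] := leqP s 700; last first.
    by apply: mul_ln_double_le => //; rewrite ler_nat ltnW.
  apply: (@le_trans _ _ (700%:R * L)); first by rewrite ler_wpM2r // ler_nat.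
  apply: mul_ln_double_le => //.
  have : ln 700 = 2 * ln 2 + (2 * ln 5 + ln 7) :> R.
    have -> : 700 = 2 ^+ 2 * (5 ^+ 2 * 7) :> R by lra.
    by rewrite !lnXM // ?mulr_gt0.
  have := ln2_bounds R; have := ln5_bounds R.
  have : ln 7 <= 3 * ln 2 :> R.
    have -> : 3 * ln 2 = ln (2 ^+ 3 * 1) :> R by rewrite lnXM // ln1; lra.
    by rewrite ler_ln ?posrE; lra.
  lra.
have := primes_between_lower n0 y2.
rewrite -(ler_nat R) natrM !natrX -muln2 natrM [n%:R * _]mulrC.
set e := (_ + _)%N => low.
have : ln (4 ^+ n * 1 : R) <= ln ((2 * n%:R) ^+ e * (4 ^+ ((n * 2) %/ 3) * 1)).
  by rewrite ler_ln ?posrE ?mulr1 // ?mulr_gt0 ?exprn_gt0 ?mulr_gt0.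
rewrite !lnXM ?ln1 ?mulr1 ?exprn_gt0 ?mulr_gt0 // !addr0 -/L.
have -> : ln 4 = 2 * ln 2 :> R.
  have -> : 4 = 2 ^+ 2 * 1 :> R by lra.
  by rewrite lnXM // ln1 addr0.
have e_le : e%:R <= s%:R + Y / 2.
  have : (2 * e <= 2 * s + y.+1)%N by move: lt_s; rewrite -muln2; exact: e_bound.
  rewrite -(ler_nat R) natrD !natrM -/Y; lra.
have d_le : ((n * 2) %/ 3)%:R <= 2 / 3 * n%:R :> R.
  have : (3 * ((n * 2) %/ 3) <= n * 2)%N by rewrite mulnC leq_divM.
  rewrite -(ler_nat R) !natrM; lra.
have h1 : e%:R * L <= s%:R * L + Y / 2 * L by rewrite -mulrDl ler_wpM2r.
have h2 : Y / 2 * L <= 27 / 1000 * Y ^+ 2.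
  by have := ler_wpM2r (ler0n R y.+1) L_le; rewrite -/Y expr2; lra.
have /andP[l2 _] := ln2_bounds R.
have h3 : ((n * 2) %/ 3)%:R * (2 * ln 2) <= 2 / 3 * n%:R * (2 * ln 2) :> R.
  by rewrite ler_wpM2r //; move: l2; clear; lra.
have h4 := ler_wpM2l (ltW n0R) l2.
move: n_geR; rewrite natrM; move: h1 h2 h3 h4 sL Y2; clear; lra.
Qed.

Theorem enough_primes (lam : R) (s : nat) :
    (0 < s)%N -> 1 <= lam -> 4 * s%:R * ln s%:R <= lam ->
  exists a b : nat, [/\ lam < a%:R, b%:R <= 2 * lam & (s <= primes_between a b)%N].
Proof.
move=> s0 lam1 slam; have [|large] := ltrP (2 * lam) (400 * 100)%N%:R.
  by move=> small; exact: enough_primes_small.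
have lam0 : 0 <= lam by lra.
(* With n the integer part of [lam], the primes in (n, 2n] lie in ([lam], 2 [lam]]. As only [lam] <
   n + 1 is known, the large case allows for 4 s ln s <= n + 1. *)
have /andP[n1 n2] := truncn_itv lam0; set n := Num.truncn lam in n1 n2.
exists n.+1, n.*2; split => //; first by rewrite -mul2n natrM ler_wpM2l.
apply: enough_primes_large.
  rewrite -ltnS -(ltr_nat R); apply: le_lt_trans n2.
  by move: large; rewrite !natrM; lra.
by rewrite natr1; apply: le_trans (ltW n2); lra.
Qed.

End enough_primes_large.

(** * Invariants of the construction *)

(** Coordinates of two elements of [I] differ by less than M, so congruent ones are equal. *)
Lemma inPI_expansion (d : nat) (I : {fset 'rV[int]_d}) M :
  prime M -> expansion I < M%:Z -> inPI I M.
Proof.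
move=> prM ltM; rewrite /inPI prM /=.
apply/eqP/card_in_imfset => k h kI hI /matrixP E.
apply/matrixP => i j; rewrite (ord1 i).
move: (E ord0 j); rewrite !mxE => /eqP; rewrite eqz_mod_dvd => dv.
apply/eqP; rewrite -subr_eq0.
have le1 : `|k ord0 j - h ord0 j| < M%:Z.
  by rewrite ltr_norml ltrNl opprB !(le_lt_trans (coord_le_expansion j _ _) ltM).
have [//|nz] := eqVneq (k ord0 j - h ord0 j) 0.
move: le1; rewrite -abszE ltz_nat ltnNge dvdn_leq // absz_gt0 //.
Qed.

Section construction.
Variables (R : realType) (d : nat) (I : {fset 'rV[int]_d}) (s : nat) (lam : R).

Lemma nextPI_spec (x : R) :
  [/\ inPI I (nextPI I x), x < (nextPI I x)%:R &
      forall M, inPI I M -> x < M%:R -> (nextPI I x <= M)%N].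
Proof.
rewrite /nextPI; case: ex_minnP => M /andP[iM xM] Mmin; split => // N iN xN.
by apply: Mmin; rewrite iN.
Qed.

Lemma enumPI_inPI l : inPI I (enumPI I lam l).
Proof.
by case: l => [|l];
  [have [] := nextPI_spec lam|have [] := nextPI_spec (enumPI I lam l)%:R].
Qed.

Lemma enumPI_prime l : prime (enumPI I lam l).
Proof. by have /andP[] := enumPI_inPI l. Qed.

Lemma enumPI_ltS l : (enumPI I lam l < enumPI I lam l.+1)%N.
Proof. by rewrite -(ltr_nat R) /=; case: (nextPI_spec (enumPI I lam l)%:R). Qed.

Lemma enumPI_mono : {homo enumPI I lam : l m / (l < m)%N}.
Proof. exact: (homo_ltn ltn_trans enumPI_ltS). Qed.

Lemma enumPI_gt l : lam < (enumPI I lam l)%:R.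
Proof.
elim: l => [|l IH]; first by case: (nextPI_spec lam).
by apply: lt_trans IH _; rewrite ltr_nat enumPI_ltS.
Qed.

Lemma enumPI_leq a b l :
    (expansion I)%:~R <= lam -> lam < a%:R ->
  (l < primes_between a b)%N -> (enumPI I lam l <= b)%N.
Proof.
move=> Ilam lama; rewrite /primes_between -size_filter.
set q := [seq p <- index_iota a b.+1 | prime p] => lq.
have qP p : p \in q -> prime p && (a <= p <= b)%N.
  by rewrite mem_filter mem_index_iota ltnS.
have qI p : p \in q -> inPI I p.
  move=> /qP /andP[pp /andP[ap _]]; apply: inPI_expansion => //.
  rewrite -(ltr_int R); apply: le_lt_trans Ilam _; apply: lt_le_trans lama _.
  by rewrite ler_nat.
have qs : sorted ltn q.
  by apply: sorted_filter; [exact: ltn_trans|exact: iota_ltn_sorted].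
(* [enumPI] always takes the least admissible prime, so it cannot overtake the increasing list [q]
   of admissible primes. *)
suff : (enumPI I lam l <= nth 0 q l)%N.
  by move/leq_trans; apply; case/andP: (qP _ (mem_nth 0%N lq)) => _ /andP[].
elim: l lq => [|l IH] lq /=.
  have [_ _] := nextPI_spec lam; apply; first exact/qI/mem_nth.
  apply: lt_le_trans lama _; rewrite ler_nat.
  by case/andP: (qP _ (mem_nth 0%N lq)) => _ /andP[].
have [_ _] := nextPI_spec (enumPI I lam l)%:R; apply; first exact/qI/mem_nth.
rewrite ltr_nat; apply: leq_ltn_trans (IH (ltnW lq)) _.
by apply: (sortedP 0%N qs).
Qed.

Lemma runD_rcons zs z :
  runD I s lam (rcons zs z) = stepD I s lam (runD I s lam zs) z.
Proof. by rewrite /runD foldl_rcons. Qed.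

Lemma runD_stopped zs zs' : ~~ runningD I s (runD I s lam zs) ->
  runD I s lam (zs ++ zs') = runD I s lam zs.
Proof.
move=> stop; elim/last_ind: zs' => [|zs' z IH]; first by rewrite cats0.
by rewrite -rcons_cat runD_rcons IH /stepD (negbTE stop).
Qed.

(** The loop invariant. Its third clause makes p_l the size of the l-th accepted lattice, from which
    distinctness and the node count follow. *)
Definition reachable (st : stateD d) : Prop :=
  [/\ covered st `<=` I, (size (lattices st) <= s)%N,
      map fst (lattices st) = mkseq (enumPI I lam) (size (lattices st)) &
      forall k, k \in covered st ->
        exists2 L, L \in lattices st & k \in alias_free I L.1 L.2].

Lemma runD_reachable zs : reachable (runD I s lam zs).
Proof.
elim/last_ind: zs => [|zs z]; first by split => //=; rewrite fsub0set.
rewrite runD_rcons; move: (runD _ _ _ _) => st rst; rewrite /stepD.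
case: ifP => // /andP[_ size_lt]; case: ifP => // _.
case: rst => covI size_le fstE covE; split => /=.
- by rewrite fsubUset covI /=; apply/fsubsetP => k; rewrite !inE => /andP[].
- by rewrite size_rcons.
- by rewrite map_rcons fstE size_rcons /mkseq -[(size _).+1]addn1 iotaD map_cat cats1.
- move=> k; rewrite inE => /orP[/covE[L Lst kL]|kJ].
    by exists L; rewrite // mem_rcons inE Lst orbT.
  by exists (modulusD I lam st, z); rewrite // mem_rcons mem_head.
Qed.

Lemma reachable_uniq st : reachable st -> uniq (map fst (lattices st)).
Proof.
case=> _ _ -> _; rewrite map_inj_uniq ?iota_uniq //.
move=> l m e; apply/eqP; have [lm|ml|//] := ltngtP l m.
  by have := enumPI_mono lm; rewrite e ltnn.
by have := enumPI_mono ml; rewrite e ltnn.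
Qed.

Lemma reachable_prime st L : reachable st -> L \in lattices st -> prime L.1.
Proof.
case=> _ _ fstE _ Lst; have : L.1 \in map fst (lattices st) by exact: map_f.
by rewrite fstE => /mapP[l _ ->]; exact: enumPI_prime.
Qed.

End construction.

Lemma card_rank1_lattice (R : realType) d (z : 'rV[int]_d) M :
  (#|` rank1_lattice R z M| <= M)%N.
Proof.
rewrite /rank1_lattice; apply: leq_trans (leq_imfset_card _ _ _) _.
by rewrite /= undup_id ?iota_uniq // size_iota.
Qed.

Lemma card_multiple_lattice (R : realType) d (L : seq (nat * 'rV[int]_d)) :
  (#|` multiple_lattice R L| <= \sum_(l <- L) l.1)%N.
Proof.
elim: L => [|l L IH]; first by rewrite /multiple_lattice !big_nil cardfs0.
rewrite /multiple_lattice !big_cons cardfsU.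
apply: leq_trans (leq_subr _ _) _; apply: leq_add => //.
exact: card_rank1_lattice.
Qed.

(** There are at most s lattices, and the l-th one has size p_l <= b <= 2 [lam], since [a, b]
    contains s primes. *)
Lemma card_reachable_lattice (R : realType) (d : nat) (I : {fset 'rV[int]_d})
    s (lam : R) a b st :
    (expansion I)%:~R <= lam -> lam < a%:R -> b%:R <= 2 * lam ->
    (s <= primes_between a b)%N -> reachable I s lam st ->
  #|` multiple_lattice R (lattices st)|%:R <= 2 * s%:R * lam.
Proof.
move=> Ilam lama blam sab [_ size_le fstE _].
have card_le : (#|` multiple_lattice R (lattices st)| <= s * b)%N.
  apply: leq_trans (card_multiple_lattice _ _) _.
  rewrite -(big_map fst xpredT id) fstE big_map.
  apply: (@leq_trans (\sum_(l <- iota 0 (size (lattices st))) b)).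
    rewrite big_seq [leqRHS]big_seq; apply: leq_sum => l; rewrite mem_iota /= => l_lt.
    by apply: enumPI_leq Ilam lama _; apply: leq_trans sab; exact: leq_trans size_le.
  rewrite big_const_seq count_predT size_iota iter_addn_0 mulnC.
  by rewrite leq_mul2r size_le orbT.
apply: (@le_trans _ _ (s * b)%N%:R); first by rewrite ler_nat.
by rewrite natrM [2 * _]mulrC -mulrA ler_wpM2l.
Qed.

(** * Reconstruction *)

Section reconstruction.
Variable R : realType.
Local Notation e := (@expi2pi R).

Lemma expi2piD t u : e (t + u) = e t * e u.
Proof.
rewrite /expi2pi mulrDr cosD sinD; apply/eqP; rewrite eq_complex /= eqxx /=.
by apply/eqP; rewrite addrC [cos _ * sin _]mulrC; congr (_ + _); rewrite mulrC.
Qed.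

Lemma expi2pi0 : e 0 = 1.
Proof. by rewrite /expi2pi mulr0 cos0 sin0. Qed.

Lemma expi2piN t : e (- t) * e t = 1.
Proof. by rewrite -expi2piD addNr expi2pi0. Qed.

Lemma expi2pi_natM n t : e (n%:R * t) = e t ^+ n.
Proof.
elim: n => [|n IH]; first by rewrite mul0r expi2pi0.
by rewrite -natr1 mulrDl mul1r expi2piD IH exprSr.
Qed.

Lemma expi2pi_int (m : int) : e m%:~R = 1.
Proof.
have e1 : e 1 = 1.
  by rewrite /expi2pi mulr1 mulr_natl cos2pi sin2pi.
have en n : e n%:R = 1 by rewrite -[n%:R]mulr1 expi2pi_natM e1 expr1n.
case: m => n; first exact: en.
by rewrite NegzE mulrNz -[LHS]mulr1 -[X in _ * X](en n.+1) expi2piN.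
Qed.

(** The real part is 1 - 2 sin(pi t)^2 < 1. *)
Lemma expi2pi_neq1 t : 0 < t < 1 -> e t != 1.
Proof.
case/andP=> t0 t1; rewrite eq_complex /= negb_and; apply/orP; left.
have pi0 := pi_gt0 R.
have s_gt0 : 0 < sin (pi * t).
  by apply: sin_gt0_pi; rewrite mulr_gt0 //= -[X in _ < X]mulr1 ltr_pM2l.
rewrite -mulrA [2 * _]mulr_natl cos_mulr2n.
have := cos2Dsin2 (pi * t); have := mulr_gt0 s_gt0 s_gt0.
by move=> h1 h2; apply/eqP => h3; rewrite expr2 in h2; rewrite !expr2 in h2 h3; lra.
Qed.

Lemma expi2pi_frac (m : int) (M : nat) : (0 < M)%N ->
  (e (m%:~R / M%:R) == 1) = (M%:Z %| m)%Z.
Proof.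
move=> M0; have M0R : 0 < M%:R :> R by rewrite ltr0n.
have MZ : M%:Z != 0 by rewrite eqz_nat -lt0n.
have -> : m%:~R / M%:R = (m %/ M)%Z%:~R + (m %% M)%Z%:~R / M%:R :> R.
  by rewrite {1}(divz_eq m M%:Z) intrD intrM mulrDl mulfK // gt_eqF.
rewrite expi2piD expi2pi_int mul1r (sameP dvdz_mod0P eqP).
have [->|nz] := eqVneq (m %% M)%Z 0.
  by rewrite mul0r expi2pi0 eqxx.
apply/negbTE/expi2pi_neq1.
rewrite divr_gt0 ?ltr0z //=; last by rewrite lt_neqAle eq_sym nz modz_ge0.
rewrite ltr_pdivrMr // mul1r -[M%:R]/((M%:Z)%:~R) ltr_int.
by apply: ltz_pmod; rewrite ltz_nat.
Qed.

Lemma sum_expi2pi (m : int) (M : nat) : (0 < M)%N ->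
  \sum_(j < M) e (j%:R * (m%:~R / M%:R)) = if (M%:Z %| m)%Z then M%:R else 0.
Proof.
move=> M0; under eq_bigr do rewrite expi2pi_natM.
rewrite -expi2pi_frac //; case: eqP => [->|/eqP w1].
  by under eq_bigr do rewrite expr1n; rewrite sumr_const card_ord.
have wM : e (m%:~R / M%:R) ^+ M = 1.
  by rewrite -expi2pi_natM mulrC divfK ?expi2pi_int // pnatr_eq0 -lt0n.
have := subrX1 (e (m%:~R / M%:R)) M; rewrite wM subrr => /esym/eqP.
by rewrite mulf_eq0 subr_eq0 (negbTE w1) => /eqP.
Qed.

Definition lattice_node (d : nat) (z : 'rV[int]_d) (M j : nat) : 'rV[R]_d :=
  \row_i (let y := (j%:R / M%:R) * (z ord0 i)%:~R in y - (Num.floor y)%:~R).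

(** Reducing the node modulo 1 changes the exponent by an integer only. *)
Lemma expi2pi_node d (k z : 'rV[int]_d) M j :
  e (\sum_(i < d) (k ord0 i)%:~R * lattice_node z M j ord0 i)
  = e (j%:R * ((dotz k z)%:~R / M%:R)).
Proof.
pose f i : int := Num.floor (j%:R / M%:R * (z ord0 i)%:~R : R).
have -> : \sum_(i < d) (k ord0 i)%:~R * lattice_node z M j ord0 i =
    j%:R * ((dotz k z)%:~R / M%:R) + (- \sum_(i < d) k ord0 i * f i)%:~R :> R.
  rewrite /dotz rmorphN /= !rmorph_sum /= mulr_suml mulr_sumr -sumrB.
  by apply: eq_bigr => i _; rewrite mxE /= -/(f i) !rmorphM /=; ring.
by rewrite expi2piD expi2pi_int mulr1.
Qed.

Lemma alias_free_row (d : nat) (I : {fset 'rV[int]_d}) (X : {fset 'rV[R]_d})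
    (M : nat) (z : 'rV[int]_d) (b : 'I_#|` I|) :
    (0 < M)%N -> rank1_lattice R z M `<=` X ->
    nth 0 (enum_fset I) b \in alias_free I M z ->
  (row b 1%:M <= fourier_matrix X I)%MS.
Proof.
move=> M0 /fsubsetP latX; set k := nth _ _ _ => kJ.
have nodeX (j : 'I_M) : lattice_node z M j \in enum_fset X.
  apply: latX; apply/imfsetP; exists (nat_of_ord j) => //=.
  by rewrite mem_iota /= add0n.
have idxP (j : 'I_M) : (index (lattice_node z M j) (enum_fset X) < #|` X|)%N.
  by have := nodeX j; rewrite -index_mem.
pose idx j := Ordinal (idxP j).
(* The weights e(-j k.z / M) / M on the lattice nodes extract column k by orthogonality. [idx] may
   fail to be injective; coinciding nodes then add their weights. *)
apply/submxP; exists (\sum_(j < M)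
   (e (- (j%:R * ((dotz k z)%:~R / M%:R))) / M%:R) *: delta_mx 0 (idx j)).
apply/rowP => c; rewrite mulmx_suml summxE.
set h := nth 0 (enum_fset I) c.
have -> : (row b 1%:M : 'rV[R[i]]_ _) 0 c = (k == h)%:R.
  rewrite !mxE; congr (_ %:R); congr nat_of_bool.
  by rewrite /k /h nth_uniq ?fset_uniq //; apply/eqP/eqP => [->//|/val_inj].
have term (j : 'I_M) : (e (- (j%:R * ((dotz k z)%:~R / M%:R))) / M%:R *:
     (delta_mx 0 (idx j) : 'rV_#|` X|) *m fourier_matrix X I) 0 c =
   M%:R^-1 * e (j%:R * ((dotz h z - dotz k z)%:~R / M%:R)).
  rewrite -scalemxAl -rowE !mxE /= nth_index // -/h expi2pi_node.
  rewrite mulrAC mulrC; congr (_ * _); rewrite -expi2piD; congr e.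
  by rewrite rmorphB /=; ring.
under eq_bigr do rewrite term.
rewrite -mulr_sumr sum_expi2pi //.
have MR : M%:R != 0 :> R[i] by rewrite pnatr_eq0 -lt0n.
have [kh|nkh] := eqVneq k h; first by rewrite -kh subrr dvdz0 mulVf.
suff -> : (M%:Z %| dotz h z - dotz k z)%Z = false by rewrite mulr0.
move: kJ; rewrite !inE => /andP[_ /allP/(_ h)].
rewrite -eqz_mod_dvd eq_sym => H; apply/negbTE/H.
have : h \in I by exact: mem_nth.
by rewrite in_fsetD1 eq_sym nkh.
Qed.

Lemma alias_free_reconstructing (d : nat) (I : {fset 'rV[int]_d})
    (L : seq (nat * 'rV[int]_d)) :
    (forall l, l \in L -> (0 < l.1)%N) ->
    (forall k, k \in I -> exists2 l, l \in L & k \in alias_free I l.1 l.2) ->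
  reconstructing (multiple_lattice R L) I.
Proof.
move=> L0 cov; apply/eqP; rewrite -[_ == _]/(row_full _) -sub1mx.
apply/row_subP => b; have [l lL kl] := cov _ (mem_nth 0 (ltn_ord b)).
apply: alias_free_row (L0 _ lL) _ kl.
exact: (@bigfcup_sup _ _ L l xpredT (fun l => rank1_lattice R l.2 l.1)).
Qed.

End reconstruction.

(** * Aliasing probabilities and the potential *)

(** Parametrises the box [0, M - 1]^d by a finite type, so that averages over a uniform draw become
    finite sums. *)
Definition box_vector (d M : nat) (f : {ffun 'I_d -> 'I_M}) : 'rV[int]_d :=
  \row_j (f j : nat)%:Z.

Lemma box_vector_inj d M : injective (@box_vector d M).
Proof.
move=> f g /rowP fg; apply/ffunP => j; apply/val_inj.
by have := fg j; rewrite !mxE => -[].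
Qed.

Lemma dotzB d (k h z : 'rV[int]_d) : dotz (k - h) z = dotz k z - dotz h z.
Proof. by rewrite /dotz -sumrB; apply: eq_bigr => j _; rewrite !mxE mulrBl. Qed.

(** Shifting coordinate j of a solution by each of the M residues maps pairs injectively into the
    box: the other coordinates determine the solution, because a_j is invertible modulo M, and then
    the shift. *)
Lemma card_hyperplane d M (a : 'rV[int]_d) (j : 'I_d) :
    prime M -> ~~ (M%:Z %| a ord0 j)%Z ->
  (#|[set f : {ffun 'I_d -> 'I_M} | (M%:Z %| dotz a (box_vector f))%Z]| * M
     <= M ^ d)%N.
Proof.
move=> prM aj; have M0 := prime_gt0 prM.
set S := [set f | _].
pose shift (x : {ffun 'I_d -> 'I_M} * 'I_M) : {ffun 'I_d -> 'I_M} :=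
  [ffun i => if i == j then Ordinal (ltn_pmod (x.1 j + x.2) M0) else x.1 i].
have inj : {in finset.setX S [set: 'I_M] &, injective shift}.
  move=> [f t] [g u]; rewrite !inE !andbT /= => fS gS /ffunP E.
  have fg i : i != j -> f i = g i.
    by move=> ij; have := E i; rewrite !ffunE /= (negbTE ij).
  have fgj : f j = g j.
    have : (M%:Z %| a ord0 j * ((f j : nat)%:Z - (g j : nat)%:Z))%Z.
      have -> : a ord0 j * ((f j : nat)%:Z - (g j : nat)%:Z) =
                dotz a (box_vector f) - dotz a (box_vector g).
        rewrite /dotz -sumrB (bigD1 j) //= big1 ?addr0 => [|i ij].
          by rewrite !mxE mulrBr.
        by rewrite !mxE fg // subrr.
      by rewrite rpredB.
    rewrite Gauss_dvdzr; last first.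
      by rewrite /coprimez /gcdz /= eqz_nat -/(coprime _ _) prime_coprime.
    rewrite -eqz_mod_dvd !modz_small; last 2 first.
    - by rewrite lez_nat ltz_nat ltn_ord.
    - by rewrite lez_nat ltz_nat ltn_ord.
    by rewrite eqz_nat => /eqP ?; apply/val_inj.
  have -> : f = g by apply/ffunP => i; have [->|/fg] := eqVneq i j.
  congr pair; apply/val_inj/eqP; have := E j; rewrite !ffunE eqxx fgj /= => -[] /eqP.
  by rewrite eqn_modDl !modn_small.
rewrite -[X in (_ * X)%N](card_ord M) -cardsT -cardsX -(card_in_imset inj).
by apply: leq_trans (max_card _) _; rewrite card_ffun !card_ord.
Qed.

Lemma inPI_neq_mod d (I : {fset 'rV[int]_d}) M (k h : 'rV[int]_d) :
    inPI I M -> k \in I -> h \in I -> k != h ->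
  exists j, ~~ (M%:Z %| (k - h) ord0 j)%Z.
Proof.
case/andP=> _ /card_in_imfsetP inj kI hI kh.
apply/existsP; apply: contraNT kh; rewrite negb_exists => /forallP H.
apply/eqP/inj => //; apply/matrixP => i j; rewrite (ord1 i) !mxE; apply/eqP.
by have := H j; rewrite negbK !mxE eqz_mod_dvd.
Qed.

(** Union bound over h != k: aliasing with h means that z lies on the hyperplane (k - h).z = 0
    modulo M. *)
Lemma card_aliased d (I : {fset 'rV[int]_d}) M k :
    inPI I M -> k \in I ->
  (#|[set f : {ffun 'I_d -> 'I_M} | k \notin alias_free I M (box_vector f)]| * M
     <= (#|` I| - 1) * M ^ d)%N.
Proof.
move=> IM kI; have /andP[prM _] := IM.
pose S h := [set f : {ffun 'I_d -> 'I_M} | (M%:Z %| dotz (k - h) (box_vector f))%Z].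
have le_sum : (#|[set f : {ffun 'I_d -> 'I_M} | k \notin alias_free I M (box_vector f)]|
               <= \sum_(h <- enum_fset (I `\ k)) #|S h|)%N.
  under eq_bigr do rewrite -sum1_card big_mkcond.
  rewrite exchange_big /= -sum1_card big_mkcond /=; apply: leq_sum => f _.
  case: ifP => //; rewrite !inE kI /= -has_predC => /hasP[h hI hz].
  rewrite (big_rem h) //= inE dotzB -eqz_mod_dvd; move: hz; rewrite /= negbK => ->.
  by [].
apply: (@leq_trans ((\sum_(h <- enum_fset (I `\ k)) #|S h|) * M)).
  by rewrite leq_mul2r le_sum orbT.
rewrite big_distrl /= 
  [leqRHS](_ : _ = \sum_(h <- enum_fset (I `\ k)) M ^ d)%N; last first.
  by rewrite big_const_seq count_predT iter_addn_0 mulnC (cardfsD1 k I) kI addKn.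
rewrite big_seq [leqRHS]big_seq; apply: leq_sum => h.
rewrite in_fsetD1 => /andP[hk hI].
have [j kj] := inPI_neq_mod IM kI hI (introN eqP (fun e => elimN eqP hk (esym e))).
exact: card_hyperplane prM kj.
Qed.

Section potential.
Variables (R : realType) (d : nat) (I : {fset 'rV[int]_d}) (s : nat) (lam c : R).
Hypothesis c_gt1 : 1 < c.
Hypothesis I_gt1 : (2 <= #|` I|)%N.
Hypothesis c_lam : c * (#|` I|%:R - 1) <= lam.

Local Notation box st := {ffun 'I_d -> 'I_(modulusD I lam st)}.
Local Notation step st f := (stepD I s lam st (box_vector f)).

Definition aliased st k : {set box st} :=
  [set f | k \notin alias_free I (modulusD I lam st) (box_vector f)].

Lemma card_aliased_le st k : k \in I ->
  c * #|aliased st k|%:R <= (modulusD I lam st ^ d)%N%:R.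
Proof.
move=> kI; rewrite /aliased /modulusD.
have := card_aliased (enumPI_inPI I lam (size (lattices st))) kI.
have := enumPI_gt I lam (size (lattices st)).
set M := enumPI _ _ _ => M_gt; move: (#|_|) => B.
rewrite -(ler_nat R) !natrM natrB ?(ltnW I_gt1) // => BM.
have T_gt0 : 0 < #|` I|%:R - 1 :> R by rewrite subr_gt0 ltr1n.
rewrite -(ler_pM2l T_gt0); apply: le_trans BM.
rewrite mulrCA mulrA [_ * B%:R]mulrC; apply: ler_wpM2l => //.
exact: le_trans c_lam (ltW M_gt).
Qed.

(** The weight c^(s~ - s) of an uncovered k; it reaches 1 when all s lattices are used up. *)
Definition miss k (st : stateD d) : R :=
  if k \in covered st then 0 else c ^+ size (lattices st) / c ^+ s.

(** Penalises a loop that is still running; the weight 2^(s - s~) is at least 1 and halves with each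
    accepted draw. *)
Definition idle (st : stateD d) : R :=
  if runningD I s st then 2 ^+ s / 2 ^+ size (lattices st) else 0.

(** [m] is the number of draws still to come. *)
Definition potential m (st : stateD d) : R :=
  \sum_(k <- enum_fset I) miss k st + idle st * ((1 + c^-1) / 2) ^+ m.

Let c_gt0 : 0 < c. Proof. exact: lt_trans c_gt1. Qed.

Lemma miss_ge0 k st : 0 <= miss k st.
Proof. by rewrite /miss; case: ifP => // _; rewrite divr_ge0 ?exprn_ge0 // ltW. Qed.

Lemma idle_ge0 st : 0 <= idle st.
Proof. by rewrite /idle; case: ifP => // _; rewrite divr_ge0 ?exprn_ge0. Qed.

Lemma potential_ge0 m st : 0 <= potential m st.
Proof.
apply: addr_ge0; first by apply: sumr_ge0 => k _; exact: miss_ge0.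
apply: mulr_ge0; first exact: idle_ge0.
by rewrite exprn_ge0 // divr_ge0 // addr_ge0 // invr_ge0 ltW.
Qed.

Lemma covered_neq_exists st : covered st `<=` I -> covered st != I ->
  exists2 k, k \in I & k \notin covered st.
Proof.
move=> sub; rewrite eqEfsubset sub /= => /fsubsetPn[k kI kcov]; by exists k.
Qed.

Lemma potential_stopped_ge1 m st : covered st `<=` I -> covered st != I ->
  ~~ runningD I s st -> 1 <= potential m st.
Proof.
move=> sub neq; rewrite /potential /idle => nrun; rewrite (negbTE nrun) mul0r addr0.
have [k kI kcov] := covered_neq_exists sub neq.
rewrite (big_rem k) //=; apply: (@le_trans _ _ (miss k st)).
  rewrite /miss (negbTE kcov) ler_pdivlMr ?exprn_gt0 // mul1r ler_eXn2l //.
  by move: nrun; rewrite /runningD neq /= -leqNgt.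
by rewrite lerDl sumr_ge0 // => h _; exact: miss_ge0.
Qed.

Lemma potential0_running_ge1 st : runningD I s st -> 1 <= potential 0 st.
Proof.
move=> run; rewrite /potential /idle run expr0 mulr1.
have /andP[_ lt] := run.
have : 1 <= 2 ^+ s / 2 ^+ size (lattices st) :> R.
  by rewrite ler_pdivlMr ?exprn_gt0 // mul1r ler_eXn2l ?ltr1n // ltnW.
move=> h; apply: le_trans h _; rewrite lerDr.
by apply: sumr_ge0 => k _; exact: miss_ge0.
Qed.

(** A draw in which an uncovered k is alias free is accepted and removes its weight. Otherwise, with
    probability at most 1/c, the weight grows at most by the factor c; so its mean does not
    increase. *)
Lemma sum_miss_step st k : k \in I -> runningD I s st ->
  \sum_(f : box st) miss k (step st f)
    <= (modulusD I lam st ^ d)%N%:R * miss k st.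
Proof.
move=> kI run; set M := modulusD I lam st.
have [kcov|kcov] := boolP (k \in covered st).
  rewrite big1 ?mulr_ge0 ?miss_ge0 // => f _; rewrite /stepD run /miss.
  by case: (_ `<=` _) => /=; rewrite ?in_fsetU ?kcov.
set w := miss k st.
have w0 : 0 <= w by exact: miss_ge0.
apply: (@le_trans _ _ (\sum_(f : box st) (if f \in aliased st k then c * w else 0))).
  apply: ler_sum => f _; rewrite inE /stepD run.
  set J := alias_free _ _ _; have [kJ|kJ] /= := boolP (k \in J).
    have acc : ~~ (J `<=` covered st) by apply: contraNN kcov => /fsubsetP; exact.
    by rewrite acc /miss /= in_fsetU kJ orbT.
  case: (J `<=` _) => /=; first by rewrite ler_peMl // ltW.
  rewrite /w /miss /= in_fsetU (negbTE kcov) (negbTE kJ) /= size_rcons.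
  by rewrite exprS mulrA.
rewrite -big_mkcond /= sumr_const -[_ *+ #|_|]mulr_natl mulrA.
by rewrite ler_wpM2r // mulrC card_aliased_le.
Qed.

(** Fix an uncovered k. With probability at least 1 - 1/c it is alias free, the draw is accepted and
    the weight at least halves; otherwise it does not grow. The mean factor is at most (1 - 1/c)/2 +
    1/c = (1 + 1/c)/2. *)
Lemma sum_idle_step st : reachable I s lam st -> runningD I s st ->
  \sum_(f : box st) idle (step st f)
    <= (modulusD I lam st ^ d)%N%:R * (idle st * ((1 + c^-1) / 2)).
Proof.
move=> [sub _ _ _] run; have /andP[neq lt] := run.
have [k kI kcov] := covered_neq_exists sub neq.
set w := idle st; have w0 : 0 <= w by exact: idle_ge0.
apply: (@le_trans _ _ (\sum_(f : box st)
    (w / 2 + (if f \in aliased st k then w / 2 else 0)))).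
  apply: ler_sum => f _; rewrite inE /stepD run.
  have wE : w / 2 = 2 ^+ s / 2 ^+ (size (lattices st)).+1.
    by rewrite /w /idle run exprSr invfM mulrA.
  have idle_le z : idle (StateD (covered st `|` z) (rcons (lattices st)
      (modulusD I lam st, box_vector f))) <= w / 2.
    rewrite wE /idle; case: ifP => [_|_]; first by rewrite /= size_rcons.
    by rewrite divr_ge0 ?exprn_ge0.
  set J := alias_free _ _ _; have [kJ|kJ] /= := boolP (k \in J).
    have acc : ~~ (J `<=` covered st) by apply: contraNN kcov => /fsubsetP; exact.
    by rewrite acc addr0.
  rewrite -splitr; case: (J `<=` _) => //=.
  by apply: le_trans (idle_le J) _; rewrite ler_pdivrMr // ler_peMr // ler1n.
rewrite big_split /= -big_mkcond /= !sumr_const card_ffun !card_ord.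
rewrite -[_ *+ #|_|]mulr_natl -[_ *+ _]mulr_natl.
have := card_aliased_le st kI; set N := (_ ^ d)%N%:R; set B := (#|_|)%:R => cB.
have {cB} : B <= N / c by rewrite ler_pdivlMr // mulrC.
have w20 : 0 <= w / 2 by rewrite divr_ge0.
move/(ler_wpM2r w20) => h.
have -> : N * (w * ((1 + c^-1) / 2)) = N * (w / 2) + N / c * (w / 2).
  by ring.
by rewrite lerD2l.
Qed.

Lemma sum_potential_step m st : reachable I s lam st -> runningD I s st ->
  \sum_(f : box st) potential m (step st f)
    <= (modulusD I lam st ^ d)%N%:R * potential m.+1 st.
Proof.
move=> reach run; rewrite /potential big_split /= mulrDr; apply: lerD.
  rewrite exchange_big /= mulr_sumr big_seq [leRHS]big_seq.
  by apply: ler_sum => k kI; exact: sum_miss_step.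
rewrite -mulr_suml exprS mulrA mulrA ler_wpM2r //.
  by rewrite exprn_ge0 // divr_ge0 // addr_ge0 // invr_ge0 ltW.
by rewrite -mulrA; exact: sum_idle_step.
Qed.

Lemma potential_init m :
  potential m (runD I s lam [::]) <=
    #|` I|%:R / c ^+ s + 2 ^+ s * ((1 + c^-1) / 2) ^+ m.
Proof.
rewrite /potential /=; apply: lerD.
  rewrite (eq_bigr (fun=> (c ^+ s)^-1)) => [|k _]; last first.
    by rewrite /miss /= expr0 mul1r.
  by rewrite big_const_seq count_predT iter_addr_0 mulr_natl.
rewrite ler_wpM2r //.
  by rewrite exprn_ge0 // divr_ge0 // addr_ge0 // invr_ge0 ltW.
by rewrite /idle; case: ifP => _ /=; rewrite ?expr0 ?divr1 // exprn_ge0.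
Qed.

End potential.

(** * Probability of failure *)

Section real_probability.
Variables (R : realType) (disp : measure_display) (Omega : measurableType disp).
Variable P : probability Omega R.
Local Open Scope classical_set_scope.

Lemma measurable_countable_valued (U : countType) (Z : Omega -> U) (Q : set U) :
  (forall v, measurable [set w | Z w = v]) -> measurable [set w | Q (Z w)].
Proof.
move=> mZ.
have -> : [set w | Q (Z w)] = \bigcup_v
    (if `[< Q v >] then [set w | Z w = v] else set0).
  apply/seteqP; split => w /=; first by move=> Qw; exists (Z w) => //; rewrite asboolT.
  by case=> v _; case: asboolP => //= Qv ->.
apply: countable_bigcupT_measurable; first exact: countableP.
by move=> v; case: ifP.
Qed.

Definition Pr (A : set Omega) : R := fine (P A).

Lemma PrE A : measurable A -> P A = (Pr A)%:E.
Proof. by move=> mA; rewrite /Pr fineK // fin_num_measure. Qed.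

Lemma Pr_ge0 A : 0 <= Pr A.
Proof. by rewrite /Pr fine_ge0. Qed.

Lemma Pr_le A B : measurable A -> measurable B -> A `<=` B -> Pr A <= Pr B.
Proof.
move=> mA mB AB; rewrite /Pr fine_le ?fin_num_measure //.
by apply: le_measure; rewrite ?inE.
Qed.

Lemma PrDI A B : measurable A -> measurable B ->
  Pr A = Pr (A `&` B) + Pr (A `\` B).
Proof.
move=> mA mB; apply: EFin_inj; rewrite EFinD -!PrE //; last 2 first.
- exact: measurableD.
- exact: measurableI.
by rewrite (measureDI P mA mB) addeC.
Qed.

Lemma Pr_partition (U : countType) (Z : Omega -> U) (vs : seq U) (A : set Omega) :
    (forall v, measurable [set w | Z w = v]) -> measurable A -> uniq vs ->
  Pr A = \sum_(v <- vs) Pr (A `&` [set w | Z w = v])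
         + Pr (A `&` [set w | Z w \notin vs]).
Proof.
move=> mZ mA; elim: vs => [_|v vs IH /= /andP[vvs uvs]].
  by rewrite big_nil add0r; congr Pr; apply/seteqP; split => w //= [].
have mN : measurable (A `&` [set w | Z w \notin vs]).
  apply: measurableI => //.
  exact: (@measurable_countable_valued _ _ (fun u => u \notin vs)).
rewrite IH // big_cons (PrDI mN (mZ v)) addrA; congr (_ + _).
  rewrite addrC; congr (Pr _ + _); apply/seteqP; split => w /= [].
    by move=> [Aw _] zv.
  by move=> Aw zv; rewrite zv.
congr Pr; apply/seteqP; split => w /=; rewrite inE negb_or.
  by move=> [[Aw ->] /eqP ->].
by move=> [Aw /andP[/eqP nv ->]].
Qed.

End real_probability.

Section draws.
Variables (R : realType) (d : nat) (I : {fset 'rV[int]_d}) (s : nat) (lam c : R).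
Hypothesis c_gt1 : 1 < c.
Hypothesis I_gt1 : (2 <= #|` I|)%N.
Hypothesis c_lam : c * (#|` I|%:R - 1) <= lam.
Variables (disp : measure_display) (Omega : measurableType disp).
Variables (P : probability Omega R) (z : nat -> Omega -> 'rV[int]_d).
Hypothesis z_draws : drawsD I s lam P z.
Local Open Scope classical_set_scope.

Lemma measurable_draw n v : measurable [set w | z n w = v].
Proof. by have [+ _] := z_draws; apply. Qed.

Lemma measurable_history n h : measurable [set w | mkseq (z ^~ w) n = h].
Proof.
elim: n h => [|n IH] h.
  have [->|/eqP h0] := eqVneq h [::].
    by rewrite (_ : mkset _ = setT) //; apply/seteqP; split.
  by rewrite (_ : mkset _ = set0) //; apply/seteqP; split => w //= /esym.
elim/last_ind: h => [|h v _].
  by rewrite (_ : mkset _ = set0) //; apply/seteqP; split => w //=;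
    rewrite mkseqS; case: mkseq.
rewrite (_ : mkset _ = [set w | mkseq (z ^~ w) n = h] `&` [set w | z n w = v]).
  by apply: measurableI; [exact: IH|exact: measurable_draw].
apply/seteqP; split => w /=; rewrite mkseqS; first by move/rcons_inj => [-> ->].
by case=> -> ->.
Qed.

Lemma measurable_history_pred n (Q : set (seq 'rV[int]_d)) :
  measurable [set w | Q (mkseq (z ^~ w) n)].
Proof.
apply: (@measurable_countable_valued _ _ _ (fun w => mkseq (z ^~ w) n)) => h.
exact: measurable_history.
Qed.

Definition past h := [set w | mkseq (z ^~ w) (size h) = h].

Definition past_uncovered m h := past h `&`
  [set w | covered (runD I s lam (mkseq (z ^~ w) (size h + m))) != I].

Lemma measurable_past h : measurable (past h).
Proof. exact: measurable_history. Qed.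

Lemma measurable_past_uncovered m h : measurable (past_uncovered m h).
Proof.
apply: measurableI; first exact: measurable_past.
exact: (@measurable_history_pred _ (fun h => covered (runD I s lam h) != I)).
Qed.

Lemma past_rcons h v : past h `&` [set w | z (size h) w = v] = past (rcons h v).
Proof.
apply/seteqP; split => w; rewrite /past /= size_rcons mkseqS.
  by case=> -> ->.
by move/rcons_inj => [-> ->].
Qed.

Lemma past_uncovered_rcons m h v :
  past_uncovered m.+1 h `&` [set w | z (size h) w = v] = past_uncovered m (rcons h v).
Proof.
by rewrite /past_uncovered setIAC past_rcons size_rcons addSnnS.
Qed.

Lemma Pr_past_rcons h (f : {ffun 'I_d -> 'I_(modulusD I lam (runD I s lam h))}) :
    runningD I s (runD I s lam h) ->
  Pr P (past (rcons h (box_vector f))) =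
  Pr P (past h) * (modulusD I lam (runD I s lam h) ^ d)%N%:R^-1.
Proof.
move=> run; apply: EFin_inj; rewrite EFinM -!PrE; [|exact: measurable_past..].
rewrite -past_rcons; have [_ zP] := z_draws.
by apply: zP => // j; rewrite mxE lez_nat ltz_nat ltn_ord.
Qed.

Lemma Pr_past_uncovered_ge1 m h : 1 <= potential I s c m (runD I s lam h) ->
  Pr P (past_uncovered m h) <= Pr P (past h) * potential I s c m (runD I s lam h).
Proof.
move=> k1; apply: le_trans (ler_peMr (Pr_ge0 P _) k1).
apply: Pr_le; [exact: measurable_past_uncovered|exact: measurable_past|].
by move=> w [].
Qed.

Lemma Pr_past_uncovered_stopped m h : ~~ runningD I s (runD I s lam h) ->
  Pr P (past_uncovered m h) <= Pr P (past h) * potential I s c m (runD I s lam h).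
Proof.
move=> stop; have [covI|neq] := eqVneq (covered (runD I s lam h)) I; last first.
  apply: Pr_past_uncovered_ge1; apply: potential_stopped_ge1 => //.
  by have [] := runD_reachable I s lam h.
have -> : past_uncovered m h = set0.
  apply/seteqP; split => w //= [pw /=]; rewrite /mkseq iotaD map_cat.
  by rewrite -/(mkseq _ _) pw runD_stopped // covI eqxx.
by rewrite /Pr measure0 mulr_ge0 ?potential_ge0 // fine_ge0.
Qed.

(** The supermartingale argument as an induction on the number of remaining draws: the event is
    split by the value of the next draw, and averaging over the box is [sum_potential_step]. *)
Lemma Pr_past_uncovered m h :
  Pr P (past_uncovered m h) <= Pr P (past h) * potential I s c m (runD I s lam h).
Proof.
elim: m h => [|m IH] h.
  have [run|stop] := boolP (runningD I s (runD I s lam h)).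
    by apply: Pr_past_uncovered_ge1; exact: potential0_running_ge1.
  exact: Pr_past_uncovered_stopped.
have [run|stop] := boolP (runningD I s (runD I s lam h)); last first.
  exact: Pr_past_uncovered_stopped.
set st := runD I s lam h in run *; set M := modulusD I lam st.
pose vs := [seq @box_vector d M f | f : {ffun 'I_d -> 'I_M}].
have uvs : uniq vs by rewrite map_inj_uniq ?enum_uniq //; exact: box_vector_inj.
have Md_gt0 : 0 < (M ^ d)%N%:R :> R.
  by rewrite ltr0n expn_gt0 prime_gt0 // enumPI_prime.
have mout : measurable [set w | z (size h) w \notin vs].
  exact: (@measurable_countable_valued _ _ _ (z (size h)) (fun u => u \notin vs)
    (measurable_draw (size h))).
(* The box already carries the full mass of the past. *)
have out0 : Pr P (past h `&` [set w | z (size h) w \notin vs]) = 0.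
  have := Pr_partition P (measurable_draw (size h)) (measurable_past h) uvs.
  rewrite big_map big_enum /=; under eq_bigr do rewrite past_rcons Pr_past_rcons //.
  rewrite sumr_const card_ffun !card_ord -[_ *+ _]mulr_natr -mulrA mulVf ?gt_eqF //.
  rewrite mulr1; lra.
rewrite (Pr_partition P (measurable_draw (size h)) (measurable_past_uncovered _ _) uvs).
rewrite [X in _ + X](_ : _ = 0) ?addr0; last first.
  apply/eqP; rewrite eq_le Pr_ge0 andbT -out0; apply: Pr_le.
  - by apply: measurableI; first exact: measurable_past_uncovered.
  - by apply: measurableI; first exact: measurable_past.
  - by move=> w [[? _] ?].
rewrite big_map big_enum /=; under eq_bigr do rewrite past_uncovered_rcons.
apply: (@le_trans _ _ (\sum_(f : {ffun 'I_d -> 'I_M}) Pr P (past h) * (M ^ d)%N%:R^-1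
    * potential I s c m (stepD I s lam st (box_vector f)))).
  apply: ler_sum => f _; apply: le_trans (IH _) _.
  by rewrite Pr_past_rcons // runD_rcons.
rewrite -mulr_sumr -mulrA ler_wpM2l ?Pr_ge0 // mulrC ler_pdivrMr // [leRHS]mulrC.
by apply: sum_potential_step => //; exact: runD_reachable.
Qed.

Lemma Pr_uncovered m :
  Pr P [set w | covered (runD I s lam (mkseq (z ^~ w) m)) != I] <=
    #|` I|%:R / c ^+ s + 2 ^+ s * ((1 + c^-1) / 2) ^+ m.
Proof.
have := Pr_past_uncovered m [::].
have -> : past [::] = setT by apply/seteqP; split.
rewrite /past_uncovered add0n.
have -> : past [::] = setT by apply/seteqP; split.
rewrite setTI {2}/Pr probability_setT mul1r => /le_trans; apply.
exact: potential_init.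
Qed.

Lemma Pr_covered_ge m :
  1 - (#|` I|%:R / c ^+ s + 2 ^+ s * ((1 + c^-1) / 2) ^+ m) <=
  Pr P [set w | covered (runD I s lam (mkseq (z ^~ w) m)) = I].
Proof.
have mU : measurable [set w | covered (runD I s lam (mkseq (z ^~ w) m)) != I].
  exact: (@measurable_history_pred _ (fun h => covered (runD I s lam h) != I)).
have -> : [set w | covered (runD I s lam (mkseq (z ^~ w) m)) = I] =
   ~` [set w | covered (runD I s lam (mkseq (z ^~ w) m)) != I].
  by apply/seteqP; split => w /=; [move=> ->; rewrite eqxx|move/negP/negPn/eqP].
have -> : Pr P (~` [set w | covered (runD I s lam (mkseq (z ^~ w) m)) != I]) =
    1 - Pr P [set w | covered (runD I s lam (mkseq (z ^~ w) m)) != I].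
  apply: EFin_inj; rewrite EFinB -!PrE ?probability_setC //.
  exact: measurableC.
by rewrite lerD2l lerN2 Pr_uncovered.
Qed.

End draws.

(** * The choice of s *)

Section number_of_lattices.
Variables (R : realType) (c delta : R).

Lemma numlat_itv T : 1 < c -> 0 < delta -> delta < 1 -> (2 <= T)%N ->
  let x := (c / (c - 1)) ^+ 2 * ((ln T%:R - ln delta) / 2) in
  (0 < numlat c delta T)%N /\ x <= (numlat c delta T)%:R < x + 1.
Proof.
move=> c_gt1 delta_gt0 delta_lt1 T2 x.
have lnT : 0 < ln T%:R :> R by rewrite ln_gt0 // ltr1n.
have lnd : ln delta < 0 by rewrite ln_lt0 // delta_gt0.
(* Positivity of [x] makes the absolute value in [numlat] harmless. *)
have x_gt0 : 0 < x.
  apply: mulr_gt0; last by apply: divr_gt0 => //; lra.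
  by rewrite exprn_gt0 // divr_gt0 //; lra.
have ceil0 : 0 < Num.ceil x by rewrite ceil_gt0.
have sE : (numlat c delta T)%:R = (Num.ceil x)%:~R :> R.
  by rewrite /numlat -/x -[LHS]/((Posz _)%:~R) abszE gtr0_norm.
split; first by rewrite -(ltr_nat R) sE ltr0z.
rewrite sE ceil_ge /=; have := ceilB1_lt x; rewrite intrB; lra.
Qed.

(** ln c >= 2 (c - 1)/(c + 1), and (c - 1)(c + 1) <= c^2. *)
Lemma ln_ge_sqr : 1 < c -> 2 * ((c - 1) / c) ^+ 2 <= ln c.
Proof.
move=> c_gt1.
apply: le_trans (ln_ge_pade (ltW c_gt1)).
have c1 : 0 < c + 1 by lra.
have c0 : 0 < c by lra.
rewrite ler_pdivlMr // expr_div_n -mulrA mulrAC mulrA ler_pdivrMr ?exprn_gt0 //.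
have : 0 <= c - 1 by lra.
nra.
Qed.

(** By [ln_ge_sqr] the factor (c/(c - 1))^2 / 2 in s cancels against ln c, leaving s ln c >= ln T -
    ln delta. *)
Lemma numlat_union_bound T : 1 < c -> 0 < delta -> delta < 1 -> (2 <= T)%N ->
  T%:R / c ^+ numlat c delta T <= delta.
Proof.
move=> c_gt1 delta_gt0 delta_lt1 T2.
have [s0 /andP[s_ge _]] := numlat_itv c_gt1 delta_gt0 delta_lt1 T2.
set s := numlat c delta T in s0 s_ge *.
have c0 : 0 < c by lra.
have T0 : 0 < T%:R :> R by rewrite ltr0n (leq_trans _ T2).
rewrite ler_pdivrMr ?exprn_gt0 //.
rewrite -ler_ln ?posrE ?mulr_gt0 ?exprn_gt0 //.
rewrite lnM ?posrE ?exprn_gt0 // lnXn // -[_ *+ s]mulr_natl.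
have lnT : 0 < ln T%:R :> R by rewrite ln_gt0 // ltr1n.
have lnd : ln delta < 0 by rewrite ln_lt0 // delta_gt0.
set D := ln T%:R - ln delta in s_ge; have D0 : 0 <= D by rewrite /D; lra.
have q0 : 0 <= 2 * ((c - 1) / c) ^+ 2 by rewrite mulr_ge0 // sqr_ge0.
suff : D <= s%:R * ln c by rewrite /D; lra.
apply: le_trans (ler_wpM2l (ler0n R s) (ln_ge_sqr c_gt1)).
apply: le_trans (ler_wpM2r q0 s_ge).
by rewrite le_eqVlt; apply/orP; left; apply/eqP; field; lra.
Qed.

Lemma numlat_log_bound : 1 < c -> 0 < delta -> delta < 1 ->
  exists C : R, forall T, (2 <= T)%N ->
    (numlat c delta T)%:R * (2 * c * (T%:R - 1)) < C * (T%:R * ln T%:R).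
Proof.
move=> c_gt1 delta_gt0 delta_lt1.
have ln2 : 0 < ln 2 :> R by rewrite ln_gt0 // ltr1n.
have lnd : ln delta < 0 by rewrite ln_lt0 // delta_gt0.
pose K := (c / (c - 1)) ^+ 2.
have K0 : 0 < K by rewrite exprn_gt0 // divr_gt0 //; lra.
(* Chosen so that s <= B ln T: as ln T >= ln 2, both -ln delta and the 1 from rounding up are
   absorbed into multiples of ln T. *)
pose B := K / 2 * (1 - ln delta / ln 2) + (ln 2)^-1.
exists (2 * c * B) => T T2.
have [_ /andP[_ s_lt]] := numlat_itv c_gt1 delta_gt0 delta_lt1 T2.
have T2R : 2 <= T%:R :> R by rewrite ler_nat.
have lnT : ln 2 <= ln T%:R :> R by rewrite ler_ln ?posrE //; lra.
have u1 : 1 <= ln T%:R / ln 2 :> R.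
  by rewrite ler_pdivlMr // mul1r.
have sB : (numlat c delta T)%:R <= B * ln T%:R.
  apply: le_trans (ltW s_lt) _; rewrite -/K.
  have -> : B * ln T%:R =
      K / 2 * (ln T%:R + - ln delta * (ln T%:R / ln 2)) + ln T%:R / ln 2.
    by rewrite /B; field; rewrite gt_eqF.
  have -> : K * ((ln T%:R - ln delta) / 2) = K / 2 * (ln T%:R + - ln delta) by field.
  by apply: lerD => //; rewrite ler_pM2l ?lerD2l ?ler_peMr //; lra.
have lnT0 : 0 < ln T%:R :> R by lra.
have B0 : 0 < B.
  rewrite addr_gt0 ?invr_gt0 // mulr_gt0 //; first lra.
  have : 0 < - ln delta / ln 2 by rewrite divr_gt0 //; lra.
  rewrite mulNr; lra.
have c2 : 0 < 2 * c by lra.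
apply: (@le_lt_trans _ _ (B * ln T%:R * (2 * c * (T%:R - 1)))).
  by rewrite ler_wpM2r // mulr_ge0 ?(ltW c2) //; lra.
have -> : 2 * c * B * (T%:R * ln T%:R) = B * ln T%:R * (2 * c * T%:R) by ring.
by rewrite ltr_pM2l ?mulr_gt0 // ltr_pM2l //; lra.
Qed.

End number_of_lattices.

Theorem corollary3p7 (R : realType) (c delta : R)
    (c_gt1 : 1 < c) (delta_gt0 : 0 < delta) (delta_lt1 : delta < 1) :
  exists C : R,
  forall (d : nat) (I : {fset 'rV[int]_d}), (2 <= #|` I|)%N ->
  let T := #|` I| in
  let s := numlat c delta T in
  let a1 := c * (T%:R - 1) in
  let a2 := (expansion I)%:~R : R in
  let a3 := 4 * s%:R * ln s%:R : R in
  let lam := Num.max (Num.max a1 a2) a3 in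
  forall (disp : measure_display) (Omega : measurableType disp)
    (P : probability Omega R) (z : nat -> Omega -> 'rV[int]_d),
  drawsD I s lam P z ->
  let success := [set w | exists n : nat,
    let st := runD I s lam (mkseq (z ^~ w) n) in
    let X := multiple_lattice R (lattices st) in
    let M := #|` X| in
    [/\ ~~ runningD I s st,
        reconstructing X I,
        uniq (map fst (lattices st)),
        M%:R <= 2 * s%:R * lam
      & a2 <= a1 -> a3 <= a1 ->
          M%:R <= s%:R * (2 * c * (T%:R - 1)) /\
          s%:R * (2 * c * (T%:R - 1)) < C * (T%:R * ln T%:R)]]%classic in
  measurable success /\ ((1 - delta)%:E <= P success)%E.

Proof.
have [C CP] := numlat_log_bound c_gt1 delta_gt0 delta_lt1.
exists C => d I I2 T s a1 a2 a3 lam disp Omega P z zP success.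
have [s0 _] := numlat_itv c_gt1 delta_gt0 delta_lt1 I2.
have a1_lam : a1 <= lam by rewrite !le_max lexx.
have a2_lam : a2 <= lam by rewrite !le_max lexx orbT.
have a3_lam : a3 <= lam by rewrite le_max lexx orbT.
have T2R : 2 <= T%:R :> R by rewrite ler_nat.
have lam1 : 1 <= lam by apply: le_trans a1_lam; rewrite /a1; nra.
have [a [b [lama blam sab]]] := enough_primes s0 lam1 a3_lam.
(* Success is expressed through finite histories, of which there are countably many; this makes the
   event measurable. *)
pose successful (h : seq 'rV[int]_d) : Prop := let st := runD I s lam h in
  let X := multiple_lattice R (lattices st) in let M := #|` X| in
  [/\ ~~ runningD I s st, reconstructing X I, uniq (map fst (lattices st)),
      M%:R <= 2 * s%:R * lam
    & a2 <= a1 -> a3 <= a1 ->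
        M%:R <= s%:R * (2 * c * (T%:R - 1)) /\
        s%:R * (2 * c * (T%:R - 1)) < C * (T%:R * ln T%:R)].
have msuccess : measurable success.
  have -> : success = (\bigcup_n [set w | successful (mkseq (z ^~ w) n)])%classic.
    by apply/seteqP; split => w; [case=> n ?; exists n|case=> n _ ?; exists n].
  by apply: bigcupT_measurable => n; exact: (measurable_history_pred zP n successful).
split => //.
have covered_success n w :
    covered (runD I s lam (mkseq (z ^~ w) n)) = I -> success w.
  move=> covI; exists n => st X M.
  have reach : reachable I s lam st by exact: runD_reachable.
  have M_le : M%:R <= 2 * s%:R * lam.
    exact: card_reachable_lattice a2_lam lama blam sab reach.
  split => //.
  - by rewrite /runningD covI eqxx.
  - apply: alias_free_reconstructing => [l lL|k kI].
      by rewrite prime_gt0 // (reachable_prime reach).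
    by case: reach => _ _ _; apply; rewrite covI.
  - exact: reachable_uniq reach.
  - move=> a21 a31; have lamE : lam = a1.
      by apply/eqP; rewrite eq_le a1_lam andbT !ge_max lexx a21.
    split; last exact: CP.
    by have -> : s%:R * (2 * c * (T%:R - 1)) = 2 * s%:R * lam by rewrite lamE /a1; ring.
(* After n draws success has probability at least 1 - delta - 2^s r^n; the last term drops below any
   [eps] for large n. *)
rewrite (PrE P msuccess) lee_fin; apply/ler_addgt0Pr => eps eps_gt0.
set r := (1 + c^-1) / 2.
have r1 : `|r| < 1.
  have c0 : 0 < c^-1 by rewrite invr_gt0; lra.
  have : c^-1 < 1 by rewrite invf_lt1; lra.
  by rewrite ger0_norm /r; lra.
have [n n_lt] : exists n, 2 ^+ s * r ^+ n < eps.
  have /cvgrPdist_lt /(_ eps eps_gt0) [n _ /(_ n (leqnn n))] :=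
    cvg_geometric (2 ^+ s) r1.
  rewrite sub0r normrN => h; exists n; exact: le_lt_trans (ler_norm _) h.
have le_Pr :
    Pr P [set w | covered (runD I s lam (mkseq (z ^~ w) n)) = I]%classic
      <= Pr P success.
  apply: Pr_le => //; last by move=> w; exact: covered_success.
  exact: (measurable_history_pred zP n (fun h => covered (runD I s lam h) = I)).
have combine (S A u v D : R) : A <= S -> u <= D -> 1 - (u + v) <= A -> v < eps ->
  1 - D <= S + eps by clear; lra.
exact: combine le_Pr (numlat_union_bound c_gt1 delta_gt0 delta_lt1 I2)
  (Pr_covered_ge c_gt1 I2 a1_lam zP n) n_lt.
Qed.
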